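(* Let $M$ be a quaternion CR-submanifold of a quaternion Kähler manifold $(\overline{M},\sigma,\overline{g})$. The following assertions are equivalent: (i) The induced metric $g$ on $M$ is bundle-like for the totally real foliation $\mathfrak{F}^\perp$. (ii) The second fundamental form $B$ of $M$ satisfies $$B(U,J_\alpha V)+B(V,J_\alpha U)\in\Gamma(\mu)\oplus J_\beta(D^\perp)\oplus J_\gamma(D^\perp)$$ (i.e. it is a section of $\mu\oplus J_\beta D^\perp\oplus J_\gamma D^\perp$) for any $U,V\in\Gamma(D)$ and any $\alpha\in\{1,2,3\}$, where $(\alpha,\beta,\gamma)$ is an even permutation of $(1,2,3)$ and $\{J_1,J_2,J_3\}$ is any canonical local basis of $\sigma$.
   Context: Quaternion Kähler manifold: a Riemannian manifold $(\overline{M},\overline{g})$ with a rank 3 subbundle $\sigma$ of $End(T\overline{M})$ which locally admits bases of sections $\{J_1,J_2,J_3\}$ (called canonical local bases) with $J_1^2=J_2^2=J_3^2=-Id$, $J_1J_2=-J_2J_1=J_3$, such that $\overline{g}(J_\alpha X,J_\alpha Y)=\overline{g}(X,Y)$ for $\alpha\in\{1,2,3\}$ and all vector fields $X,Y$, and such that $\sigma$ is parallel with respect to the Levi-Civita connection $\overline{\nabla}$ of $\overline{g}$. Quaternion CR-submanifold: a submanifold $M$ of $\overline{M}$, with induced metric $g$ and Levi-Civita connection $\nabla$, admitting two orthogonal complementary distributions $D$ and $D^\perp$ (so $TM=D\oplus D^\perp$) such that, for every $x\in M$, every canonical local basis and every $\alpha\in\{1,2,3\}$, $J_\alpha(D_x)\subseteq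 D_x$ and $J_\alpha(D^\perp_x)\subseteq T_xM^\perp$ (the normal space). $D$ is called the quaternion distribution and $D^\perp$ the totally real distribution. $B$ denotes the second fundamental form of $M$ in $\overline{M}$: $\overline{\nabla}_XY=\nabla_XY+B(X,Y)$ for $X,Y\in\Gamma(TM)$. The normal bundle decomposes orthogonally as $TM^\perp=\mu\oplus\mu^\perp$, where $\mu^\perp=J_1D^\perp\oplus J_2D^\perp\oplus J_3D^\perp$ and $\mu$ is the orthogonal complement of $\mu^\perp$ in $TM^\perp$. It is known that $D^\perp$ is always integrable; the foliation $\mathfrak{F}^\perp$ of $M$ with tangent distribution $D^\perp$ and transversal distribution $D$ is called the (canonical) totally real foliation. The metric $g$ is bundle-like for $\mathfrak{F}^\perp$ if the metric induced on the transversal distribution $D$ is parallel with respect to the intrinsic connection on $D$; equivalently, $g(\nabla_UX,V)+g(\nabla_VX,U)=0$ for all $X\in\Gamma(D^\perp)$ and $U,V\in\Gamma(D)$. *)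

(* Defs.v *)
(* Smooth manifolds, Riemannian metrics, Levi-Civita
   connections, quaternion Kähler manifolds and quaternion CR-submanifolds. *)
From HB Require Import structures.
From mathcomp Require Import all_boot all_order all_algebra all_fingroup.
From mathcomp Require Import all_classical all_reals all_analysis.
Set Implicit Arguments.
Unset Strict Implicit.
Unset Printing Implicit Defensive.
Import Order.TTheory GRing.Theory Num.Theory.
Import numFieldNormedType.Exports.
Local Open Scope classical_set_scope.
Local Open Scope ring_scope.

(** * Smooth manifolds *)

(* [Ck k A h] : h is of class C^k on A, which is always an open set below. *)
Fixpoint Ck (R : realType) (n : nat) (V : normedModType R) (k : nat)
    (A : set 'rV[R]_n) (h : 'rV[R]_n -> V) : Prop :=
  if k is k'.+1 then
    (forall x, A x -> differentiable h x) /\ (forall v, Ck k' A ('D_v h))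
  else forall x, A x -> {for x, continuous h}.

Definition smooth (R : realType) (n : nat) (V : normedModType R)
    (A : set 'rV[R]_n) (h : 'rV[R]_n -> V) : Prop := forall k, Ck k A h.

(* [cpsi] is the inverse of the coordinate map [cphi]; both are total
   functions that are only meaningful on [cdom] and [cimg c]. *)
Record chart (R : realType) (n : nat) (T : topologicalType) := Chart {
  cdom : set T;
  cphi : T -> 'rV[R]_n;
  cpsi : 'rV[R]_n -> T;
  cdom_open : open cdom;
  cimg_open : open (cphi @` cdom);
  cphiK : forall x, cdom x -> cpsi (cphi x) = x;
  cphi_continuous : {within cdom, continuous cphi};
  cpsi_continuous : {within cphi @` cdom, continuous cpsi} }.

(* The preferred chart [chart_at x] around x only serves to identify T_x M with
   R^n (see below); no notion depends on its choice beyond that. *)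
Record manifold (R : realType) (n : nat) := Manifold {
  mcarrier :> topologicalType;
  mhausdorff : hausdorff_space mcarrier;
  msecond_countable : @second_countable mcarrier;
  atlas : set (chart R n mcarrier);
  chart_at : mcarrier -> chart R n mcarrier;
  chart_at_atlas : forall x, atlas (chart_at x);
  chart_at_dom : forall x, cdom (chart_at x) x;
  atlas_compat : forall c c', atlas c -> atlas c' ->
    smooth (cphi c @` (cdom c `&` cdom c')) (cphi c' \o cpsi c) }.
Arguments atlas {R n} m _.

Definition smooth_fun (R : realType) (n : nat) (M : manifold R n)
    (V : normedModType R) (O : set M) (h : M -> V) : Prop :=
  forall c, atlas M c -> smooth (cphi c @` (cdom c `&` O)) (h \o cpsi c).

(** ** Tangent vectors

   The tangent space at x is R^n: a vector is represented by its components in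
   the chart [chart_at x].  [tcoord c x v] gives the components in another chart
   c of v in T_x M, and [coord_vf c i] is the coordinate vector field d/dx_i
   of c.  A vector field on M is a function M -> 'rV_n. *)

Section Tangent.
Variables (R : realType) (n : nat) (M : manifold R n).

Definition tcoord (c : chart R n M) (x : M) (v : 'rV[R]_n) : 'rV[R]_n :=
  'd (cphi c \o cpsi (chart_at x)) (cphi (chart_at x) x) v.

Definition coord_vf (c : chart R n M) (i : 'I_n) (x : M) : 'rV[R]_n :=
  'd (cphi (chart_at x) \o cpsi c) (cphi c x) (delta_mx 0 i).

(* derivative of h at x in the direction v of T_x M *)
Definition der (V : normedModType R) (h : M -> V) (x : M) (v : 'rV[R]_n) : V :=
  'd (h \o cpsi (chart_at x)) (cphi (chart_at x) x) v.

Definition smooth_vf (O : set M) (X : M -> 'rV[R]_n) : Prop :=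
  forall c, atlas M c ->
    smooth_fun (O `&` cdom c) (fun x => tcoord c x (X x)).

Definition smooth_end (O : set M) (S : M -> 'End('rV[R]_n)) : Prop :=
  forall c i, atlas M c ->
    smooth_vf (O `&` cdom c) (fun x => S x (coord_vf c i x)).

(* [X, Y]^k = X(Y^k) - Y(X^k) in the coordinates of [chart_at x] *)
Definition lie (X Y : M -> 'rV[R]_n) (x : M) : 'rV[R]_n :=
  der (fun y => tcoord (chart_at x) y (Y y)) x (X x) -
  der (fun y => tcoord (chart_at x) y (X y)) x (Y x).

(* [D x] is a subspace of T_x M, [D] a smooth subbundle of T M *)
Definition smooth_distribution (D : M -> {vspace 'rV[R]_n}) : Prop :=
  exists r : nat, forall x, exists O : set M,
    [/\ open O, O x &
     exists E : 'I_r -> M -> 'rV[R]_n,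
       (forall i, smooth_vf O (E i)) /\
       (forall y, O y -> basis_of (D y) [seq E i y | i <- enum 'I_r])].

Definition is_section (D : M -> {vspace 'rV[R]_n}) (O : set M)
    (X : M -> 'rV[R]_n) : Prop :=
  smooth_vf O X /\ forall x, O x -> X x \in D x.

End Tangent.

(** ** Riemannian metrics and Levi-Civita connections *)

Section Riemannian.
Variables (R : realType) (n : nat) (M : manifold R n).

Definition tensor2 := M -> 'rV[R]_n -> 'rV[R]_n -> R.

Record riemannian (g : tensor2) : Prop := {
  riem_linear : forall x a u v w, g x (a *: u + v) w = a * g x u w + g x v w;
  riem_sym : forall x u v, g x u v = g x v u;
  riem_pos : forall x u, u != 0 -> 0 < g x u u;
  riem_smooth : forall c i j, atlas M c ->
    smooth_fun (cdom c) (fun x => g x (coord_vf c i x) (coord_vf c j x) : R^o) }.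

(* [nb x v Y] is the covariant derivative at x, in the direction v of T_x M, of
   a vector field Y defined and smooth around x (Y is only constrained on a
   neighbourhood O of x; that the result does not depend on Y outside O follows
   from [nabla_leibniz]). *)
Definition connection_op := M -> 'rV[R]_n -> (M -> 'rV[R]_n) -> 'rV[R]_n.

Record connection (nb : connection_op) : Prop := {
  nabla_linear : forall (O : set M) Y, open O -> smooth_vf O Y ->
    forall x, O x -> forall a v w,
      nb x (a *: v + w) Y = a *: nb x v Y + nb x w Y;
  nabla_additive : forall (O : set M) Y Z, open O ->
    smooth_vf O Y -> smooth_vf O Z ->
    forall x, O x -> forall v,
      nb x v (fun y => Y y + Z y) = nb x v Y + nb x v Z;
  nabla_leibniz : forall (O : set M) (h : M -> R) Y, open O ->
    smooth_fun O (h : M -> R^o) -> smooth_vf O Y ->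
    forall x, O x -> forall v,
      nb x v (fun y => h y *: Y y) =
        der (h : M -> R^o) x v *: Y x + h x *: nb x v Y;
  nabla_smooth : forall (O : set M) X Y, open O ->
    smooth_vf O X -> smooth_vf O Y -> smooth_vf O (fun x => nb x (X x) Y) }.

Record levi_civita (g : tensor2) (nb : connection_op) : Prop := {
  lc_connection : connection nb;
  lc_torsion_free : forall (O : set M) X Y, open O ->
    smooth_vf O X -> smooth_vf O Y ->
    forall x, O x -> nb x (X x) Y - nb x (Y x) X = lie X Y x;
  lc_metric : forall (O : set M) Y Z, open O ->
    smooth_vf O Y -> smooth_vf O Z ->
    forall x, O x -> forall v,
      der (fun y => g y (Y y) (Z y) : R^o) x v =
        g x (nb x v Y) (Z x) + g x (Y x) (nb x v Z) }.

(* the g-orthogonal complement in T_x M of a subspace W of T_x M *)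
Definition orth_compl (g : tensor2) (x : M) (W : {vspace 'rV[R]_n}) :
    {vspace 'rV[R]_n} :=
  (\bigcap_(w <- vbasis W) lker (linfun (fun v => g x v w : R^o)))%VS.

(** ** Bundle-like metrics *)

(* For complementary distributions [D] (transversal) and [Dp] (tangent to the
   foliation), with projections Q onto D and Q' onto Dp, the intrinsic
   connection on D (Bejancu and Farran, Foliations and Geometric Structures) is
      X, V |-> Q (nabla_{Q X} V) + Q [Q' X, V],
   V a section of D. *)
Definition intrinsic (nb : connection_op) (D Dp : M -> {vspace 'rV[R]_n})
    (X V : M -> 'rV[R]_n) (x : M) : 'rV[R]_n :=
  let Q y := daddv_pi (D y) (Dp y) in
  let Q' y := daddv_pi (Dp y) (D y) in
  Q x (nb x (Q x (X x)) V) + Q x (lie (fun y => Q' y (X y)) V x).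

(* the metric induced on D is parallel for the intrinsic connection *)
Definition bundle_like (g : tensor2) (nb : connection_op)
    (D Dp : M -> {vspace 'rV[R]_n}) : Prop :=
  forall (O : set M) X U V, open O ->
    smooth_vf O X -> is_section D O U -> is_section D O V ->
    forall x, O x ->
      der (fun y => g y (U y) (V y) : R^o) x (X x) =
        g x (intrinsic nb D Dp X U x) (V x) +
        g x (U x) (intrinsic nb D Dp X V x).

(** ** Quaternion Kähler manifolds *)

(* [J 0], [J 1], [J 2] are J_1, J_2, J_3; [sigma x] is a subspace of
   End(T_x M), and [basis_of] forces its dimension to be 3. *)
Record canonical_basis (g : tensor2) (sigma : M -> {vspace 'End('rV[R]_n)})
    (O : set M) (J : 'I_3 -> M -> 'End('rV[R]_n)) : Prop := {
  canonical_smooth : forall a, smooth_end O (J a);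
  canonical_basis_of : forall x, O x ->
    basis_of (sigma x) [seq J a x | a <- enum 'I_3];
  canonical_square : forall x, O x -> forall a, (J a x \o J a x)%VF = - \1%VF;
  canonical_mul : forall x, O x -> (J 0 x \o J 1 x)%VF = J 2 x;
  canonical_anti : forall x, O x -> (J 1 x \o J 0 x)%VF = - J 2 x;
  canonical_isometry : forall x, O x -> forall a u v,
    g x (J a x u) (J a x v) = g x u v }.

(* [qk_parallel]: the covariant derivative of a local section S of sigma, i.e.
   the endomorphism (nabla_v S) Y = nabla_v (S Y) - S (nabla_v Y), is again
   in sigma. *)
Record quaternion_kahler (g : tensor2) (nb : connection_op)
    (sigma : M -> {vspace 'End('rV[R]_n)}) : Prop := {
  qk_riemannian : riemannian g;
  qk_levi_civita : levi_civita g nb;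
  qk_basis : forall x, exists O J, [/\ open O, O x & canonical_basis g sigma O J];
  qk_parallel : forall (O : set M) S, open O ->
    smooth_end O S -> (forall x, O x -> S x \in sigma x) ->
    forall x, O x -> forall v, exists2 T, T \in sigma x &
      forall (P : set M) Y, open P -> P `<=` O -> P x -> smooth_vf P Y ->
        nb x v (fun y => S y (Y y)) - S x (nb x v Y) = T (Y x) }.

End Riemannian.

(** * Submanifolds *)

Section Submanifold.
Variables (R : realType) (m n : nat) (M : manifold R m) (N : manifold R n).
Variable f : M -> N.

Definition smooth_map : Prop :=
  continuous f /\
  forall c, atlas N c -> smooth_fun (f @^-1` cdom c) (cphi c \o f).

(* the differential of f at x, T_x M -> T_{f x} N *)
Definition dmap (x : M) : 'Hom('rV[R]_m, 'rV[R]_n) :=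
  linfun (der (cphi (chart_at (f x)) \o f) x).

Definition immersion : Prop := smooth_map /\ forall x, lker (dmap x) = 0%VS.

Definition induced_metric (g : tensor2 N) : tensor2 M :=
  fun x u v => g (f x) (dmap x u) (dmap x v).

Definition push (X : M -> 'rV[R]_m) (x : M) : 'rV[R]_n := dmap x (X x).

(* The covariant derivative in direction v of a vector field Y along f
   (Y x in T_{f x} N), induced by a connection on N: for Y = sum y_i (E_i o f)
   with (E_i) the coordinate frame of N around f x, it is
     sum v(y_i) E_i + y_i nabla_{df v} E_i.
   When Y is the restriction of a vector field of N defined around f x, this is
   the derivative of that vector field in the direction df v. *)
Definition nabla_along (nb : connection_op N) (x : M) (v : 'rV[R]_m)
    (Y : M -> 'rV[R]_n) : 'rV[R]_n :=
  let c := chart_at (f x) in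
  \sum_(i < n)
    (der (fun y => tcoord c (f y) (Y y) 0 i : R^o) x v *: coord_vf c i (f x) +
     tcoord c (f x) (Y x) 0 i *: nb (f x) (dmap x v) (coord_vf c i)).

(* second fundamental form, by the Gauss formula; [nbN] and [nbM] are the
   Levi-Civita connections of N and of M *)
Definition sff (nbN : connection_op N) (nbM : connection_op M)
    (X Y : M -> 'rV[R]_m) (x : M) : 'rV[R]_n :=
  nabla_along nbN x (X x) (push Y) - dmap x (nbM x (X x) Y).

Definition normal_at (g : tensor2 N) (x : M) : {vspace 'rV[R]_n} :=
  orth_compl g (f x) (limg (dmap x)).

(* J acting on vector fields of M that it leaves tangent to M: the inverse is
   that of the injective map df, applied to elements of its image *)
Definition tangent_J (J : N -> 'End('rV[R]_n)) (V : M -> 'rV[R]_m) (x : M) :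
    'rV[R]_m := ((dmap x)^-1)%VF (J (f x) (push V x)).

(* f_*(W) and J(f_*(W)) for a subspace W of T_x M *)
Definition pushv (x : M) (W : {vspace 'rV[R]_m}) := (dmap x @: W)%VS.
Definition Jpushv (J : N -> 'End('rV[R]_n)) (x : M) (W : {vspace 'rV[R]_m}) :=
  (J (f x) @: pushv x W)%VS.

Record quaternion_CR (g : tensor2 N) (sigma : N -> {vspace 'End('rV[R]_n)})
    (D Dp : M -> {vspace 'rV[R]_m}) : Prop := {
  cr_D : smooth_distribution D;
  cr_Dp : smooth_distribution Dp;
  cr_complementary : forall x, (D x + Dp x)%VS = fullv;
  cr_orthogonal : forall x u v, u \in D x -> v \in Dp x ->
    induced_metric g x u v = 0;
  cr_D_invariant : forall (O : set N) J, open O -> canonical_basis g sigma O J ->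
    forall x, O (f x) -> forall a, (Jpushv (J a) x (D x) <= pushv x (D x))%VS;
  cr_Dp_real : forall (O : set N) J, open O -> canonical_basis g sigma O J ->
    forall x, O (f x) -> forall a,
      (Jpushv (J a) x (Dp x) <= normal_at g x)%VS }.

Definition mu_perp (J : 'I_3 -> N -> 'End('rV[R]_n))
    (Dp : M -> {vspace 'rV[R]_m}) (x : M) : {vspace 'rV[R]_n} :=
  (\sum_(a < 3) Jpushv (J a) x (Dp x))%VS.

Definition mu (g : tensor2 N) (J : 'I_3 -> N -> 'End('rV[R]_n))
    (Dp : M -> {vspace 'rV[R]_m}) (x : M) : {vspace 'rV[R]_n} :=
  (normal_at g x :&: orth_compl g (f x) (mu_perp J Dp x))%VS.

End Submanifold.

(* Main.v *)
Require Import Defs.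
From HB Require Import structures.
From mathcomp Require Import all_boot all_order all_algebra all_fingroup.
From mathcomp Require Import all_classical all_reals all_analysis.
From mathcomp Require Import lra ring.
Import Order.TTheory GRing.Theory Num.Theory.
Import numFieldNormedType.Exports.
Local Open Scope classical_set_scope.
Local Open Scope ring_scope.

Set Implicit Arguments.
Unset Strict Implicit.
Unset Printing Implicit Defensive.

(* Let X be a section of Dp and U, V sections of D.  Differentiating
   g(X, V) = 0 and using that nabla is torsion free, bundle-likeness of g
   becomes g(X, nabla_U V + nabla_V U) = 0 for all X, U, V.  On the other hand
   J_a X is normal while sigma V is tangent to M; as sigma is parallel, this
   gives g(B(U, J_a V), J_a X) = g(J_a nablabar_U V, J_a X) = g(nabla_U V, X).
   Finally J_1 Dp, J_2 Dp, J_3 Dp are mutually orthogonal, so a normal vector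
   lies in mu + J_b Dp + J_c Dp iff it is orthogonal to J_a Dp.

   The Gauss formula (B, which is defined as a difference, is normal) amounts
   to the uniqueness of the Levi-Civita connection of M: the connection induced
   along f is metric, and it is torsion free by the symmetry of the second
   derivatives of f in charts. *)

(** * Functions of class C^k *)

(** Vector fields are total functions of which only the germ at a point matters, and connections are
    operators on such functions; so differentiation is carried out on germs read in charts, where
    most identities hold only near a point. The axioms of a connection concern smooth fields, while
    two of the fields involved are given by pointwise linear algebra: the [Dp]-component of X inside
    the intrinsic connection, and the field of M that df sends to J_a df V. Their components solve a
    linear system t A = b with smooth coefficients and independent rows, so t = b A^T (A A^T)^-1 is
    smooth. The condition g(X, nabla_U V + nabla_V U) = 0 mentions neither J nor the permutation.
    For the converse, a single canonical basis around each point and the identity permutation are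
    therefore enough. *)

Section NearDiff.
Variables (R : realType) (V W : normedModType R).

(** The first-order expansion at [a] only sees the germ, and a continuous linear map satisfying it
    is the differential. This allows replacing one expression by another under ['d] when they agree
    only on a chart domain. *)
Lemma near_eq_is_diff (f g : V -> W) (a : V) :
  (\near a, f a = g a) -> differentiable f a ->
  differentiable g a /\ 'd g a = 'd f a :> (V -> W).
Proof.
move=> fg df; have /diff_locallyP [cf ef] := df.
have fga : f a = g a by exact: nbhs_singleton fg.
have eg : g \o shift a = cst (g a) + 'd f a +o_ 0 id.
  apply/eqaddoP => e e0; move/eqaddoP : ef => /(_ _ e0).
  have : \forall h \near 0, f (h + a) = g (h + a).
    by move: fg; rewrite (near_shift 0) subr0.
  apply: filter_app2; near=> h => fgh.
  by rewrite !fctE /= fgh fga.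
have dg : 'd g a = 'd f a :> (V -> W) by exact: diff_unique.
by split; [apply/diff_locallyP; rewrite dg; split|exact: dg].
Unshelve. all: by end_near. Qed.

Lemma near_eq_differentiable (f g : V -> W) (a : V) :
  (\near a, f a = g a) -> differentiable f a -> differentiable g a.
Proof. by move=> fg df; have [] := near_eq_is_diff fg df. Qed.

Lemma near_eq_diff (f g : V -> W) (a : V) :
  (\near a, f a = g a) -> differentiable f a -> 'd f a = 'd g a :> (V -> W).
Proof. by move=> fg df; have [_ ->] := near_eq_is_diff fg df. Qed.

End NearDiff.

Section CkTheory.
Variables (R : realType) (n : nat).
Implicit Types (A B : set 'rV[R]_n) (p q : 'rV[R]_n) (k : nat).

Lemma Ck_sub (V : normedModType R) k A B (h : 'rV[R]_n -> V) :
  A `<=` B -> Ck k B h -> Ck k A h.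
Proof.
move=> AB; elim: k h => [|k IH] h /=; first by move=> H x /AB /H.
by move=> [H1 H2]; split=> [x /AB /H1//|v]; exact: IH.
Qed.

(** [Ck] is a condition at each point of the set, with derivatives taken in the ambient space, so it
    can be checked point by point. *)
Lemma Ck_local (V : normedModType R) k A (h : 'rV[R]_n -> V) :
  (forall p, A p -> exists2 B, B p & Ck k B h) -> Ck k A h.
Proof.
elim: k h => [|k IH] h /= H.
  by move=> x /H [B Bx]; apply.
split=> [x /H [B Bx [+ _]]|v]; first exact.
by apply: IH => p /H [B Bp [_ CB]]; exists B.
Qed.

(** Openness turns equality on [A] into equality of germs, which survives each ['D_v]. *)
Lemma Ck_eq (V : normedModType R) k A (h h' : 'rV[R]_n -> V) :
  open A -> (forall p, A p -> h p = h' p) -> Ck k A h -> Ck k A h'.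
Proof.
move=> oA; elim: k h h' => [|k IH] h h' e /= H.
  move=> x Ax; have cx := H x Ax.
  have nA : \forall y \near x, h y = h' y.
    by apply: filterS (open_nbhs_nbhs (conj oA Ax)).
  rewrite /prop_for /continuous_at -(e _ Ax).
  exact: (cvg_trans (near_eq_cvg (F := nbhs x) nA) cx).
have nA x : A x -> \near x, h x = h' x.
  by move=> Ax; apply: filterS (open_nbhs_nbhs (conj oA Ax)).
case: H => H1 H2; split=> [x Ax|v].
  exact: near_eq_differentiable (nA _ Ax) (H1 _ Ax).
apply: IH (H2 v) => p Ap; exact: near_eq_derive (nA _ Ap).
Qed.

Lemma CkW (V : normedModType R) k A (h : 'rV[R]_n -> V) : Ck k.+1 A h -> Ck k A h.
Proof.
elim: k h => [|k IH] h [H1 H2].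
  by move=> x Ax; apply: differentiable_continuous; exact: H1.
by split=> // v; apply: IH.
Qed.

Lemma Ck_cst (V : normedModType R) k A (a : V) : Ck k A (cst a : 'rV[R]_n -> V).
Proof.
elim: k a => [|k IH] a /=; first by move=> x _; exact: cst_continuous.
split=> // v; rewrite (_ : 'D_v _ = cst 0) //.
by apply/funext => x; rewrite derive_cst.
Qed.

Lemma Ck_lin (V W : normedModType R) k A (L : {linear V -> W})
  (h : 'rV[R]_n -> V) : open A -> continuous L -> Ck k A h -> Ck k A (L \o h).
Proof.
move=> oA cL; elim: k h => [|k IH] h /=.
  by move=> H x Ax; apply: continuous_comp; [exact: H|exact: cL].
move=> [H1 H2]; have dLh x : A x -> differentiable (L \o h) x.
  by move=> Ax; apply: differentiable_comp (H1 _ Ax) (linear_differentiable _ _).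
split=> // v; apply: Ck_eq (IH _ (H2 v)) => // p Ap /=.
rewrite (deriveE _ (H1 _ Ap)) (deriveE _ (dLh _ Ap)).
have e : 'd (L \o h) p = 'd L (h p) \o 'd h p :> (_ -> _).
  by apply: diff_comp; [exact: H1|exact: linear_differentiable].
by rewrite e -[in LHS](diff_lin (h p) cL).
Qed.

Lemma CkD (V : normedModType R) k A (g h : 'rV[R]_n -> V) :
  open A -> Ck k A g -> Ck k A h -> Ck k A (fun p => g p + h p).
Proof.
move=> oA; elim: k g h => [|k IH] g h /=.
  by move=> H H' x Ax; apply: (@continuousD _ _ _ g h); [exact: H|exact: H'].
move=> [H1 H2] [H3 H4].
split=> [x Ax|v]; first by apply: (@differentiableD _ _ _ g h); [exact: H1|exact: H3].
apply: Ck_eq (IH _ _ (H2 v) (H4 v)) => // p Ap /=.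
by apply/esym/(@deriveD _ _ _ g h); apply: diff_derivable; [exact: H1|exact: H3].
Qed.

Lemma Ck_sum (V : normedModType R) k A (I : Type) (r : seq I) (P : pred I)
    (h : I -> 'rV[R]_n -> V) :
  open A -> (forall i, P i -> Ck k A (h i)) ->
  Ck k A (fun p => \sum_(i <- r | P i) h i p).
Proof.
move=> oA H; elim: r => [|i r IH].
  by rewrite (_ : (fun p => _) = cst 0); [exact: Ck_cst|apply/funext=> p; rewrite big_nil].
case: (boolP (P i)) => Pi; last first.
  rewrite (_ : (fun p => _) = (fun p => \sum_(j <- r | P j) h j p)) //.
  by apply/funext => p; rewrite big_cons (negbTE Pi).
rewrite (_ : (fun p => _) = (fun p => h i p + \sum_(j <- r | P j) h j p)).
  by apply: CkD => //; exact: H.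
by apply/funext => p; rewrite big_cons Pi.
Qed.

Lemma CkM k A (g h : 'rV[R]_n -> R^o) :
  open A -> Ck k A g -> Ck k A h -> Ck k A (fun p => (g p * h p : R^o)).
Proof.
move=> oA; elim: k g h => [|k IH] g h.
  by move=> /= Cg Ch x Ax; apply: (@continuousM R _ g h x); [exact: Cg|exact: Ch].
move=> Cg Ch; have [H1 H2] := Cg; have [H3 H4] := Ch.
split=> [x Ax|v]; first by apply: (@differentiableM R _ g h); [exact: H1|exact: H3].
apply: (@Ck_eq _ k A (fun p => g p * 'D_v h p + 'D_v g p * h p : R^o)) => //.
  move=> p Ap; apply/esym.
  have := @deriveM R _ g h p v (diff_derivable (H1 _ Ap)) (diff_derivable (H3 _ Ap)).
  by move=> e; apply: (etrans e); rewrite [h p *: _](@mulrC R).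
have C1 : Ck k A (fun p => g p * 'D_v h p : R^o) by apply: IH; [exact: CkW|exact: H4].
have C2 : Ck k A (fun p => 'D_v g p * h p : R^o) by apply: IH; [exact: H2|exact: CkW].
exact: CkD oA C1 C2.
Qed.

(** The derivative of the inverse contains the inverse again, but only one order less of it is
    required, so the induction closes with [CkM]. *)
Lemma CkV k A (h : 'rV[R]_n -> R^o) :
  open A -> (forall p, A p -> h p != 0) -> Ck k A h ->
  Ck k A (fun p => ((h p)^-1 : R^o)).
Proof.
move=> oA h0; elim: k => [|k IH].
  by move=> /= Ch x Ax; apply: (@continuousV R); [exact: h0|exact: Ch].
move=> Ch; have [H1 H2] := Ch; split=> [x Ax|v].
  by apply: (@differentiableV R); [exact: H1|exact: h0].
apply: (@Ck_eq _ k A (fun p => (-1) * (((h p)^-1 * (h p)^-1) * 'D_v h p) : R^o)) => //.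
  move=> p Ap; have := @deriveV R _ h p v (h0 _ Ap) (diff_derivable (H1 _ Ap)).
  by move=> e; apply/esym/(etrans e); rewrite /GRing.scale /= -expr2 exprVn mulN1r mulNr.
apply: CkM => //; first exact: Ck_cst.
by apply: CkM => //; [apply: CkM => //; apply: IH; exact: CkW|exact: H2].
Qed.

End CkTheory.

(** * Coordinates and composition *)

Section Coordinates.
Variables (R : realType) (m : nat).

(** Named so as to carry a linear structure to which [Ck_lin] applies; [linef] plays the same role
    for rebuilding a row from its entries. *)
Definition coordf (j : 'I_m) (v : 'rV[R]_m) : R^o := v 0 j.

Lemma coordf_is_linear j : linear (coordf j).
Proof. by move=> a u v; rewrite /coordf !mxE. Qed.

HB.instance Definition _ j :=
  GRing.isLinear.Build R 'rV[R]_m R^o *:%R (coordf j) (coordf_is_linear j).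

Lemma coordf_continuous j : continuous (coordf j).
Proof. exact: coord_continuous. Qed.

Definition linef (V : normedModType R) (e : V) (r : R^o) : V := r *: e.

Lemma linef_is_linear (V : normedModType R) e : linear (@linef V e).
Proof. by move=> a u v; rewrite /linef scalerDl scalerA. Qed.

HB.instance Definition _ (V : normedModType R) e :=
  GRing.isLinear.Build R R^o V *:%R (@linef V e) (linef_is_linear e).

Lemma linef_continuous (V : normedModType R) (e : V) : continuous (linef e).
Proof. exact: scalel_continuous. Qed.

Lemma row_sum_coord (v : 'rV[R]_m) : v = \sum_j v 0 j *: delta_mx 0 j.
Proof. exact: row_sum_delta. Qed.

Lemma Ck_coordP n k (A : set 'rV[R]_n) (h : 'rV[R]_n -> 'rV[R]_m) : open A ->
  Ck k A h <-> forall j, Ck k A (fun p => h p 0 j : R^o).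
Proof.
move=> oA; split=> [H j|H].
  exact: (@Ck_lin _ _ _ _ k A (coordf j) h oA (@coordf_continuous j)).
rewrite (_ : h = fun p => \sum_j linef (delta_mx 0 j) (h p 0 j)).
  apply: Ck_sum => // j _.
  exact: (Ck_lin oA (@linef_continuous _ (delta_mx 0 j : 'rV[R]_m)) (H j)).
by apply/funext => p; rewrite [LHS]row_sum_coord.
Qed.

End Coordinates.

Section CkComp.
Variables (R : realType) (n m : nat).

Lemma diff_sum_coord (V : normedModType R) (h : 'rV[R]_m -> V) (q w : 'rV[R]_m) :
  'd h q w = \sum_i w 0 i *: 'd h q (delta_mx 0 i).
Proof.
rewrite {1}[w]row_sum_coord linear_sum; apply: eq_bigr => i _.
by rewrite linearZ.
Qed.

(** [Ck] differentiates in fixed directions, whereas the chain rule differentiates [h] in the moving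
    direction ['D_v g p]. Expanding that direction in the standard basis leaves products of
    coordinates of ['D_v g] with compositions of partial derivatives of [h] with [g], to which the
    induction hypothesis applies. *)
Lemma Ck_comp_scalar k (A : set 'rV[R]_n) (B : set 'rV[R]_m)
    (g : 'rV[R]_n -> 'rV[R]_m) (h : 'rV[R]_m -> R^o) :
  open A -> A `<=` g @^-1` B -> Ck k A g -> Ck k B h ->
  Ck k A (h \o g).
Proof.
move=> oA AB; elim: k h => [|k IH] h.
  move=> /= Cg Ch x Ax; apply: continuous_comp; first exact: Cg.
  by apply: Ch; exact: AB.
move=> Cg Ch; have [g1 g2] := Cg; have [h1 h2] := Ch.
have dgh p : A p -> differentiable (h \o g) p.
  by move=> Ap; apply: differentiable_comp; [exact: g1|exact/h1/AB].
split=> // v.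
apply: (@Ck_eq _ _ _ k A
  (fun p => \sum_i ('D_v g p) 0 i * ('D_(delta_mx 0 i) h \o g) p : R^o)) => //.
  move=> p Ap; rewrite (deriveE _ (dgh _ Ap)).
  have e : 'd (h \o g) p = 'd h (g p) \o 'd g p :> (_ -> _).
    by apply: diff_comp; [exact: g1|exact/h1/AB].
  rewrite e /= [RHS]diff_sum_coord; apply: eq_bigr => i _ /=.
  by rewrite (deriveE _ (g1 _ Ap)) (deriveE _ (h1 _ (AB _ Ap))).
apply: Ck_sum => // i _; apply: CkM => //.
  by move: i; apply/Ck_coordP => //; exact: g2.
by apply: IH; [exact: CkW|exact: h2].
Qed.

End CkComp.

(** * Symmetry of second derivatives *)

Section Schwarz.
Variables (R : realType) (n : nat).
Implicit Types (p v w : 'rV[R]_n).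

Lemma is_derive_line (h : 'rV[R]_n -> R) (v b : 'rV[R]_n) (s : R) :
  differentiable h (s *: v + b) ->
  is_derive s 1 (fun s => h (s *: v + b)) ('D_v h (s *: v + b)).
Proof.
move=> dh.
have dl : is_diff s (fun s : R => s *: v + b) ( *:%R ^~ v).
  have d1 : is_diff s ( *:%R ^~ v : R -> _) ( *:%R ^~ v) by exact: is_diff_scalel.
  have d2 := is_diffD d1 (is_diff_cst b s).
  by move: d2; rewrite addr0.
have dc : differentiable (h \o (fun s : R => s *: v + b)) s.
  by apply: differentiable_comp => //; exact: ex_diff.
apply: DeriveDef; first exact: diff_derivable.
rewrite (deriveE _ dc) (deriveE _ dh).
have -> : 'd (h \o (fun s : R => s *: v + b)) s =
          'd h (s *: v + b) \o 'd (fun s : R => s *: v + b) s :> (_ -> _).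
  by apply: diff_comp => //; exact: ex_diff.
by rewrite /= diff_val scale1r.
Qed.

(** With the increment along [w] frozen, the mean value theorem in the direction [v] writes the
    second difference as [t] times an increment of ['D_v h]; the first-order expansion of ['D_v h]
    at [p] evaluates that increment. *)
Lemma second_difference (h : 'rV[R]_n -> R) p v w :
  (\forall q \near p, differentiable h q) -> differentiable ('D_v h : _ -> R) p ->
  forall e, 0 < e -> \forall t \near 0^'+,
  `|(h (t *: v + (p + t *: w)) - h (t *: v + p)) - (h (p + t *: w) - h p)
    - t ^+ 2 * 'D_w ('D_v h : _ -> R) p| <= e * t ^+ 2.
Proof.
move=> dh dG e e0; set G := 'D_v h : _ -> R.
(* The expansion of [G] is used at two points within t(|v| + |w|) of [p], hence the factor 2; the 1
   keeps [C] positive when [v] and [w] vanish. *)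
pose C := 2 * (`|v| + `|w|) + 1.
have C0 : 0 < C by rewrite /C ltr_pwDr// mulr_ge0// addr_ge0.
have eC : 0 < e / C by rewrite divr_gt0.
have /diff_locally/eqaddoP/(_ _ eC) := dG.
move=> /nbhs_ballP[d1 /= d10 Hd1].
move: dh => /nbhs_ballP[d2 /= d20 Hd2].
pose d := Num.min d1 d2.
have d0 : 0 < d by rewrite lt_min d10.
near=> t.
have t0 : 0 < t by [].
have td : t * C < d.
  rewrite -ltr_pdivlMr//; near: t; apply: nbhs_right_lt; exact: divr_gt0.
have small a b : 0 <= a <= t -> 0 <= b <= t -> `|a *: v + b *: w| < d.
  move=> /andP[a0 at_] /andP[b0 bt]; apply: le_lt_trans td.
  rewrite (le_trans (ler_normD _ _))// !normrZ !ger0_norm// /C.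
  have A1 : a * `|v| <= t * `|v| by rewrite ler_wpM2r.
  have A2 : b * `|w| <= t * `|w| by rewrite ler_wpM2r.
  have A3 : 0 <= t * `|v| by rewrite mulr_ge0// ltW.
  have -> : t * C = 2 * (t * `|v|) + 2 * (t * `|w|) + t by rewrite /C; ring.
  have A4 : 0 <= t * `|w| by rewrite mulr_ge0// ltW.
  move: A1 A2 A3 A4 (ltW t0); lra.
have dfh a b : 0 <= a <= t -> 0 <= b <= t -> differentiable h (a *: v + (p + b *: w)).
  move=> Ha Hb; apply: Hd2; rewrite -ball_normE /=.
  have -> : p - (a *: v + (p + b *: w)) = - (a *: v + b *: w).
    by rewrite [a *: v + _]addrCA opprD addrA subrr add0r.
  by rewrite normrN (lt_le_trans (small _ _ Ha Hb))// ge_min lexx orbT.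
have estG a b : 0 <= a <= t -> 0 <= b <= t ->
  `|G (a *: v + (p + b *: w)) - G p - 'd G p (a *: v + b *: w)| <= e / C * (t * (`|v| + `|w|)).
  move=> Ha Hb; have := Hd1 (a *: v + b *: w).
  rewrite -ball_normE /= sub0r normrN (lt_le_trans (small _ _ Ha Hb)) ?ge_min ?lexx//.
  move=> /(_ isT); rewrite opprD addrA => H.
  have -> : a *: v + (p + b *: w) = a *: v + b *: w + p by rewrite addrCA [RHS]addrC.
  apply: le_trans H _; apply: (ler_wpM2l (ltW eC)).
  move: Ha Hb => /andP[a0 at_] /andP[b0 bt].
  rewrite (le_trans (ler_normD _ _))// !normrZ !ger0_norm// mulrDr.
  by rewrite lerD// ler_wpM2r.
pose phi s := h (s *: v + (p + t *: w)) - h (s *: v + p).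
have dphi s : 0 <= s <= t ->
  is_derive s 1 phi (G (s *: v + (p + t *: w)) - G (s *: v + p)).
  move=> Hs; apply: is_deriveB; apply: is_derive_line.
    by apply: dfh => //; rewrite lexx ltW.
  by have := dfh s 0 Hs; rewrite scale0r addr0; apply; rewrite lexx ltW.
(* The intermediate point depends on [t], but being between 0 and [t] it stays in the range of
   [estG]. *)
have [c ct E] : exists2 c, c \in `]0, t[%R &
    phi t - phi 0 = (G (c *: v + (p + t *: w)) - G (c *: v + p)) * (t - 0).
  apply: MVT => //.
    by move=> x; rewrite in_itv /= => /andP[x0 xt]; apply: dphi; rewrite !ltW.
  apply: derivable_within_continuous => x; rewrite in_itv /= => Hx.
  by have [] := dphi x Hx.
have tt : 0 <= t <= t by rewrite lexx ltW.
have t00 : (0 : R) <= 0 <= t by rewrite lexx ltW.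
have Hc : 0 <= c <= t by move: ct; rewrite in_itv /= => /andP[c0 ct]; rewrite !ltW.
have H1 := estG c t Hc tt.
have H2 := estG c 0 Hc t00.
move: E H2; rewrite /phi !scale0r !add0r !addr0 subr0 => -> H2.
set DW := 'D_w G p.
have e1 : 'd G p (c *: v + t *: w) = 'd G p (c *: v) + t * DW.
  by rewrite linearD [X in _ + X]linearZ /DW (deriveE _ dG).
move: H1; rewrite e1.
set X := G _; set Y := G (_ + p) in H2 *; set L := 'd G p _ in H2 *.
move=> H1.
have K : e / C * (t * (`|v| + `|w|)) * 2 <= e * t.
  have -> : e / C * (t * (`|v| + `|w|)) * 2 = e * t * (2 * (`|v| + `|w|) / C).
    by field; rewrite gt_eqF.
  rewrite -[leRHS]mulr1; apply: ler_wpM2l; first by rewrite mulr_ge0 ?ltW.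
  apply: ltW.
  by rewrite ltr_pdivrMr// mul1r /C ltrDl.
have -> : (X - Y) * t - t ^+ 2 * DW = t * ((X - G p - (L + t * DW)) - (Y - G p - L)).
  by ring.
rewrite normrM (gtr0_norm t0) expr2 mulrCA; apply: (ler_wpM2l (ltW t0)).
apply: le_trans (ler_normB _ _) _; apply: le_trans K.
by rewrite mulr_natr mulr2n lerD.
Unshelve. all: by end_near.
Qed.

(* Both sides are the limit of the same second difference divided by t ^ 2. *)
Lemma derive_comm (h : 'rV[R]_n -> R) p v w :
  (\forall q \near p, differentiable h q) ->
  differentiable ('D_v h : _ -> R) p -> differentiable ('D_w h : _ -> R) p ->
  'D_w ('D_v h : _ -> R) p = 'D_v ('D_w h : _ -> R) p.
Proof.
move=> dh dv dw; apply/eqP; rewrite -subr_eq0 -normr_le0; apply/ler_addgt0Pr => e e0.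
rewrite add0r; set A := 'D_w _ p; set B := 'D_v _ p.
have e2 : 0 < e / 2 by rewrite divr_gt0.
have Hv := second_difference w dh dv e2; have Hw := second_difference v dh dw e2.
have [t [t0 [HA HB]]] := filter_ex (filterI (nbhs_right_gt (0 : R)) (filterI Hv Hw)).
have {}t0 : 0 < t := t0.
move: HB HA; rewrite -/A -/B.
rewrite (_ : t *: w + (p + t *: v) = t *: v + (p + t *: w)); last first.
  by rewrite addrC -addrA addrCA.
rewrite ![p + _]addrC; set a := h _; set b := h _; set c := h _; set d := h _.
(* Exchanging [v] and [w] only exchanges the two middle terms of the second difference. *)
rewrite (_ : a - b - (c - d) = a - c - (b - d)); last by ring.
set X := _ - (b - d) => HB HA.
have t20 : 0 < t ^+ 2 by rewrite exprn_gt0.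
rewrite -(ler_pM2l t20) -{1}(gtr0_norm t20) -normrM.
have -> : t ^+ 2 * (A - B) = (X - t ^+ 2 * B) - (X - t ^+ 2 * A) by ring.
apply: le_trans (ler_normB _ _) _.
have -> : t ^+ 2 * e = e / 2 * t ^+ 2 + e / 2 * t ^+ 2 by field.
apply: lerD. 
exact: HB.
exact: HA.
Qed.

End Schwarz.

(** * Germs of smooth functions *)

Lemma nbhs_open (T : topologicalType) (p : T) (S : set T) :
  nbhs p S -> exists2 B, open_nbhs p B & B `<=` S.
Proof. by rewrite nbhsE => -[B Bp BS]; exists B. Qed.

Section SmoothAt.
Variables (R : realType) (n : nat).
Implicit Types (p q u v w : 'rV[R]_n) (A B : set 'rV[R]_n).

(** One neighbourhood serves all orders of differentiation, so smoothness at [p] passes to nearby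
    points and to derivatives. *)
Definition smooth_at (V : normedModType R) p (h : 'rV[R]_n -> V) : Prop :=
  exists2 A, open_nbhs p A & smooth A h.

Lemma smooth_at_near (V : normedModType R) p (h : 'rV[R]_n -> V) :
  smooth_at p h -> \forall q \near p, smooth_at q h.
Proof.
move=> [A [oA Ap] sA]; apply: filterS (open_nbhs_nbhs (conj oA Ap)) => q Aq.
by exists A.
Qed.

Lemma smooth_at_eq (V : normedModType R) p (h h' : 'rV[R]_n -> V) :
  (\near p, h p = h' p) -> smooth_at p h -> smooth_at p h'.
Proof.
move=> e [A Ap sA]; have [B Bp BA] := nbhs_open (filterI e (open_nbhs_nbhs Ap)).
 exists B => // k.
apply: (@Ck_eq _ _ _ k B h h'); first by case: Bp.
  by move=> q /BA [].
by apply: Ck_sub (sA k) => q /BA [].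
Qed.

Lemma smooth_at_ext (V : normedModType R) p (h h' : 'rV[R]_n -> V) :
  h =1 h' -> smooth_at p h -> smooth_at p h'.
Proof. by move=> /funext ->. Qed.

Lemma smooth_at_differentiable (V : normedModType R) p (h : 'rV[R]_n -> V) :
  smooth_at p h -> differentiable h p.
Proof. by move=> [A [_ Ap] sA]; have [+ _] := sA 1%N; exact. Qed.

Lemma smooth_at_continuous (V : normedModType R) p (h : 'rV[R]_n -> V) :
  smooth_at p h -> {for p, continuous h}.
Proof. by move=> /smooth_at_differentiable/differentiable_continuous. Qed.

Lemma smooth_at_derive (V : normedModType R) p (h : 'rV[R]_n -> V) v :
  smooth_at p h -> smooth_at p ('D_v h).
Proof. by move=> [A Ap sA]; exists A => // k; have [_ +] := sA k.+1; exact. Qed.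

Lemma smooth_at_diff (V : normedModType R) p (h : 'rV[R]_n -> V) v :
  smooth_at p h -> smooth_at p (fun q => 'd h q v).
Proof.
move=> sh; apply: smooth_at_eq (smooth_at_derive v sh).
apply: filterS (smooth_at_near sh) => q sq.
exact/deriveE/smooth_at_differentiable.
Qed.

Lemma smooth_at_smooth (V : normedModType R) A (h : 'rV[R]_n -> V) :
  (forall p, A p -> smooth_at p h) -> smooth A h.
Proof.
by move=> H k; apply: Ck_local => p /H [B [_ Bp] sB]; exists B => //; exact: sB.
Qed.

Lemma smooth_at_cst (V : normedModType R) p (a : V) : smooth_at p (cst a).
Proof. by exists setT; [split => //; exact: openT|move=> k; exact: Ck_cst]. Qed.

Lemma smooth_atD (V : normedModType R) p (g h : 'rV[R]_n -> V) :
  smooth_at p g -> smooth_at p h -> smooth_at p (fun q => g q + h q).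
Proof.
move=> [A [oA Ap] sA] [B [oB Bp] sB]; have oAB := openI oA oB.
exists (A `&` B) => // k; apply: CkD => //.
  by apply: Ck_sub (sA k); exact: subIsetl.
by apply: Ck_sub (sB k); exact: subIsetr.
Qed.

Lemma smooth_at_sum (V : normedModType R) p (I : Type) (r : seq I) (P : pred I)
    (h : I -> 'rV[R]_n -> V) :
  (forall i, P i -> smooth_at p (h i)) ->
  smooth_at p (fun q => \sum_(i <- r | P i) h i q).
Proof.
move=> H; elim: r => [|i r IH].
  by apply: smooth_at_ext (smooth_at_cst p 0) => q; rewrite big_nil.
case: (boolP (P i)) => Pi; last first.
  by apply: smooth_at_ext IH => q; rewrite big_cons (negbTE Pi).
by apply: smooth_at_ext (smooth_atD (H i Pi) IH) => q; rewrite big_cons Pi.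
Qed.

Lemma smooth_atM p (g h : 'rV[R]_n -> R^o) :
  smooth_at p g -> smooth_at p h -> smooth_at p (fun q => g q * h q : R^o).
Proof.
move=> [A [oA Ap] sA] [B [oB Bp] sB]; have oAB := openI oA oB.
exists (A `&` B) => // k; apply: CkM => //.
  by apply: Ck_sub (sA k); exact: subIsetl.
by apply: Ck_sub (sB k); exact: subIsetr.
Qed.

Lemma smooth_at_prod p (I : Type) (r : seq I) (P : pred I)
    (h : I -> 'rV[R]_n -> R^o) :
  (forall i, P i -> smooth_at p (h i)) ->
  smooth_at p (fun q => \prod_(i <- r | P i) (h i q : R) : R^o).
Proof.
move=> H; elim: r => [|i r IH].
  by apply: smooth_at_ext (smooth_at_cst p (1 : R^o)) => q; rewrite big_nil.
case: (boolP (P i)) => Pi; last first.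
  by apply: smooth_at_ext IH => q; rewrite big_cons (negbTE Pi).
by apply: smooth_at_ext (smooth_atM (H i Pi) IH) => q; rewrite big_cons Pi.
Qed.

Lemma smooth_atV p (h : 'rV[R]_n -> R^o) : h p != 0 ->
  smooth_at p h -> smooth_at p (fun q => (h q)^-1 : R^o).
Proof.
move=> h0 sh; have ch := smooth_at_continuous sh.
have n0 : \forall q \near p, h q != 0.
  exact: cvgr_neq0 ch h0.
case: sh => A Ap sA; have [B Bp BA] := nbhs_open (filterI n0 (open_nbhs_nbhs Ap)).
 exists B => // k; apply: CkV.
- by case: Bp.
- by move=> q /BA [].
- by apply: Ck_sub (sA k) => q /BA [].
Qed.

Lemma smooth_at_coordP m p (h : 'rV[R]_n -> 'rV[R]_m) :
  smooth_at p h <-> forall j, smooth_at p (fun q => h q 0 j : R^o).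
Proof.
split=> [[A Ap sA] j|H].
  by exists A => // k; move: j; apply/Ck_coordP => //; case: Ap.
suff [A Ap sA] : exists2 A, open_nbhs p A & forall j, smooth A (fun q => h q 0 j : R^o).
  by exists A => // k; apply/Ck_coordP => [|j]; [case: Ap|exact: sA].
have /nbhs_open[A Ap HA] : \forall q \near p, forall j, smooth_at q (fun q => h q 0 j : R^o).
  by apply: (filter_forall (F := nbhs p)) => j; exact/smooth_at_near.
 exists A => // j.
by apply: smooth_at_smooth => q /HA.
Qed.

Lemma smooth_atZ m p (g : 'rV[R]_n -> R^o) (h : 'rV[R]_n -> 'rV[R]_m) :
  smooth_at p g -> smooth_at p h -> smooth_at p (fun q => (g q : R) *: h q).
Proof.
move=> sg sh; apply/smooth_at_coordP => j.
by apply: smooth_at_ext (smooth_atM sg ((smooth_at_coordP _ _).1 sh j)) => q; rewrite mxE.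
Qed.

End SmoothAt.

Section SmoothAtComp.
Variables (R : realType) (n m : nat).
Implicit Types (p : 'rV[R]_n).

Lemma smooth_at_comp_scalar p (g : 'rV[R]_n -> 'rV[R]_m) (h : 'rV[R]_m -> R^o) :
  smooth_at p g -> smooth_at (g p) h -> smooth_at p (h \o g).
Proof.
move=> sg [B Bgp sB].
have nB : nbhs p (g @^-1` B).
  by have cg := smooth_at_continuous sg; exact: (cg _ (open_nbhs_nbhs Bgp)).
case: sg => A Ap sA; have [C Cp CAB] := nbhs_open (filterI nB (open_nbhs_nbhs Ap)).
 exists C => // k.
apply: (@Ck_comp_scalar _ _ _ k C B) => //; first by case: Cp.
  by move=> q /CAB [].
by apply: Ck_sub (sA k) => q /CAB [].
Qed.

Lemma smooth_at_comp l p (g : 'rV[R]_n -> 'rV[R]_m) (h : 'rV[R]_m -> 'rV[R]_l) :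
  smooth_at p g -> smooth_at (g p) h -> smooth_at p (h \o g).
Proof.
move=> sg /smooth_at_coordP sh; apply/smooth_at_coordP => j.
exact: smooth_at_comp_scalar (sh j).
Qed.

Lemma smooth_at_diffapp p (F : 'rV[R]_n -> 'rV[R]_m) (w : 'rV[R]_n -> 'rV[R]_n) :
  smooth_at p F -> smooth_at p w -> smooth_at p (fun q => 'd F q (w q)).
Proof.
move=> sF sw.
apply: (@smooth_at_ext _ _ _ _ (fun q => \sum_i w q 0 i *: 'd F q (delta_mx 0 i))).
  by move=> q; rewrite -diff_sum_coord.
apply: smooth_at_sum => i _; apply: smooth_atZ; last exact: smooth_at_diff.
by move: i; apply/smooth_at_coordP.
Qed.

End SmoothAtComp.

(** * Rules for differentials of smooth germs *)

Section DiffRules.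
Variables (R : realType) (n : nat).
Implicit Types (p q u v w : 'rV[R]_n).

Lemma smooth_at_near_diff (V : normedModType R) p (f g : 'rV[R]_n -> V) :
  smooth_at p f -> (\near p, f p = g p) -> 'd f p = 'd g p :> (_ -> _).
Proof. by move=> /smooth_at_differentiable df fg; exact: near_eq_diff. Qed.

Lemma diff_coord m p (F : 'rV[R]_n -> 'rV[R]_m) v j :
  smooth_at p F -> ('d F p v) 0 j = 'd (fun q => F q 0 j : R^o) p v.
Proof.
move=> /smooth_at_differentiable dF.
have dc : differentiable (@coordf R m j) (F p).
  exact: (linear_differentiable _ (@coordf_continuous R m j)).
have e : 'd (coordf j \o F) p = 'd (coordf j) (F p) \o 'd F p :> (_ -> _).
  exact: (diff_comp dF dc).
rewrite -[RHS]/('d (coordf j \o F) p v) e /=.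
by rewrite (diff_lin (F p) (@coordf_continuous R m j)).
Qed.

Lemma diff_addE (V : normedModType R) p (g h : 'rV[R]_n -> V) v :
  smooth_at p g -> smooth_at p h ->
  'd (fun q => g q + h q) p v = 'd g p v + 'd h p v.
Proof.
move=> /smooth_at_differentiable dg /smooth_at_differentiable dh.
by have := diffD dg dh => /(congr1 (@^~ v)).
Qed.

Lemma diff_cstE (V : normedModType R) p (a : V) v : 'd (fun _ : 'rV[R]_n => a) p v = 0.
Proof. by have := diff_cst a p => /(congr1 (@^~ v)). Qed.

Lemma diff_sumE (V : normedModType R) p (I : Type) (r : seq I) (h : I -> 'rV[R]_n -> V) v :
  (forall i, smooth_at p (h i)) ->
  'd (fun q => \sum_(i <- r) h i q) p v = \sum_(i <- r) 'd (h i) p v.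
Proof.
move=> H; elim: r => [|i r IH].
  rewrite big_nil (_ : (fun q => _) = (fun=> 0)) ?diff_cstE//.
  by apply/funext => q; rewrite big_nil.
rewrite big_cons -IH -diff_addE; [|exact: H|exact: smooth_at_sum].
by congr ('d _ p v); apply/funext => q; rewrite big_cons.
Qed.

Lemma diff_mulE p (g h : 'rV[R]_n -> R^o) v :
  smooth_at p g -> smooth_at p h ->
  'd (fun q => g q * h q : R^o) p v = ('d g p v : R) * h p + g p * 'd h p v.
Proof.
move=> /smooth_at_differentiable dg /smooth_at_differentiable dh.
have e : 'd (fun q => g q * h q : R^o) p v = g p * 'd h p v + h p * 'd g p v.
  exact: (congr1 (@^~ v) (@diffM R _ g h p dg dh)).
by apply: (etrans e); apply: (etrans (addrC _ _)); apply: (congr1 (+%R^~ _)); exact: (@mulrC R).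
Qed.

Lemma diff_scaleE m p (g : 'rV[R]_n -> R^o) (h : 'rV[R]_n -> 'rV[R]_m) v :
  smooth_at p g -> smooth_at p h ->
  'd (fun q => (g q : R) *: h q) p v = ('d g p v : R) *: h p + (g p : R) *: 'd h p v.
Proof.
move=> sg sh; apply/rowP => j; rewrite diff_coord; last exact: smooth_atZ.
have shj : smooth_at p (fun q => h q 0 j : R^o) by move: j; apply/smooth_at_coordP.
rewrite !mxE (diff_coord _ _ sh) -(diff_mulE v sg shj).
by congr ('d _ p v); apply/funext => q; rewrite mxE.
Qed.

(** The product rule for q |-> DF(q) w(q). It separates the second derivative of [F], symmetric by
    [diff_comm], from the derivative of [w]; torsion freeness along a map rests on this
    splitting. *)
Lemma diff_diffapp m p (F : 'rV[R]_n -> 'rV[R]_m) (w : 'rV[R]_n -> 'rV[R]_n) u :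
  smooth_at p F -> smooth_at p w ->
  'd (fun q => 'd F q (w q)) p u =
  'd (fun q => 'd F q (w p)) p u + 'd F p ('d w p u).
Proof.
move=> sF sw.
have swi i : smooth_at p (fun q => w q 0 i : R^o) by move: i; apply/smooth_at_coordP.
have sFi i : smooth_at p (fun q => 'd F q (delta_mx 0 i)) by exact: smooth_at_diff.
rewrite (_ : (fun q => 'd F q (w q)) = fun q => \sum_i w q 0 i *: 'd F q (delta_mx 0 i)); last first.
  by apply/funext => q; rewrite -diff_sum_coord.
rewrite (_ : (fun q => 'd F q (w p)) = fun q => \sum_i w p 0 i *: 'd F q (delta_mx 0 i)); last first.
  by apply/funext => q; rewrite -diff_sum_coord.
have e1 := diff_sumE (index_enum 'I_n) u (fun i => smooth_atZ (swi i) (sFi i)).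
have e2 := diff_sumE (index_enum 'I_n) u (fun i => smooth_atZ (smooth_at_cst p (w p 0 i : R^o)) (sFi i)).
apply: (etrans e1); apply: etrans (congr2 +%R (esym e2) (esym (diff_sum_coord F p _))).
rewrite -big_split; apply: eq_bigr => i _.
apply: (etrans (diff_scaleE u (swi i) (sFi i))); rewrite addrC.
congr (_ + _); last by congr (_ *: _); exact: esym (diff_coord u i sw).
apply: esym; apply: (etrans (diff_scaleE u (smooth_at_cst p (w p 0 i : R^o)) (sFi i))).
by rewrite [X in X *: _](diff_cstE p (w p 0 i : R^o) u) scale0r add0r.
Qed.

Lemma diff_comm m p (F : 'rV[R]_n -> 'rV[R]_m) v w : smooth_at p F ->
  'd (fun q => 'd F q v) p w = 'd (fun q => 'd F q w) p v.
Proof.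
move=> sF; apply/rowP => j.
have sFj : smooth_at p (fun q => F q 0 j : R^o) by move: j; apply/smooth_at_coordP.
have key x y : ('d (fun q => 'd F q x) p y) 0 j =
    'D_y ('D_x (fun q => F q 0 j : R^o)) p.
  rewrite diff_coord; last exact: smooth_at_diff.
  rewrite (deriveE _ (smooth_at_differentiable (smooth_at_derive _ sFj))).
  rewrite -[LHS](congr1 (@^~ y) (smooth_at_near_diff (smooth_at_derive x sFj) _)) //.
  apply: filterS2 (smooth_at_near sF) (smooth_at_near sFj) => q s1 s2.
  by rewrite (deriveE _ (smooth_at_differentiable s2)) (diff_coord _ _ s1).
rewrite !key; apply: (@derive_comm R n (fun q => F q 0 j)).
- by apply: filterS (smooth_at_near sFj) => q; exact: smooth_at_differentiable.
- exact/smooth_at_differentiable/(smooth_at_derive _ sFj).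
- exact/smooth_at_differentiable/(smooth_at_derive _ sFj).
Qed.

(** * Linear systems with smooth coefficients *)

Definition smooth_mx r m p (A : 'rV[R]_n -> 'M[R]_(r, m)) :=
  forall i j, smooth_at p (fun q => A q i j : R^o).

Lemma smooth_mxM r m l p (A : 'rV[R]_n -> 'M[R]_(r, m)) (B : 'rV[R]_n -> 'M[R]_(m, l)) :
  smooth_mx p A -> smooth_mx p B -> smooth_mx p (fun q => A q *m B q).
Proof.
move=> sA sB i j.
apply: (@smooth_at_ext _ _ _ _ (fun q => \sum_k (A q i k * B q k j) : R^o)).
  by move=> q; rewrite mxE.
by apply: smooth_at_sum => k _; apply: smooth_atM.
Qed.

Lemma smooth_mx_tr r m p (A : 'rV[R]_n -> 'M[R]_(r, m)) :
  smooth_mx p A -> smooth_mx p (fun q => (A q)^T).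
Proof.
move=> sA i j; apply: smooth_at_ext (sA j i) => q; by rewrite mxE.
Qed.

Lemma smooth_mx_det r p (A : 'rV[R]_n -> 'M[R]_r) :
  smooth_mx p A -> smooth_at p (fun q => \det (A q) : R^o).
Proof.
move=> sA; rewrite /determinant; apply: smooth_at_sum => s _.
apply: smooth_atM; first exact: smooth_at_cst.
by apply: smooth_at_prod => i _; exact: sA.
Qed.

(** By Cramer's rule each entry is a cofactor divided by the determinant. *)
Lemma smooth_mx_inv r p (A : 'rV[R]_n -> 'M[R]_r) :
  (\forall q \near p, A q \in unitmx) -> smooth_mx p A ->
  smooth_mx p (fun q => invmx (A q)).
Proof.
move=> uA sA i j.
apply: (@smooth_at_eq _ _ _ _ (fun q => (\det (A q))^-1 * cofactor (A q) j i : R^o)).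
  by apply: filterS uA => q Aq; rewrite /invmx Aq !mxE.
apply: smooth_atM.
  apply: smooth_atV; last exact: smooth_mx_det.
  by have := nbhs_singleton uA; rewrite unitmxE unitfE.
apply: smooth_atM; first exact: smooth_at_cst.
apply: smooth_mx_det => k l; apply: smooth_at_ext (sA (lift j k) (lift i l)) => q.
by rewrite !mxE.
Qed.

(** Over the reals u A A^T = 0 gives |u A|^2 = 0, and independence of the rows then forces u = 0. *)
Lemma row_free_gram r m (A : 'M[R]_(r, m)) : row_free A -> A *m A^T \in unitmx.
Proof.
move=> fA; rewrite -row_free_unit; apply/row_freeP; apply/row_freeP.
rewrite -kermx_eq0; apply/rowV0P => u /sub_kermxP uA.
have : (u *m A) *m (u *m A)^T = 0 by rewrite trmx_mul !mulmxA -(mulmxA u) uA mul0mx.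
move=> /matrixP/(_ 0 0); rewrite !mxE.
have -> : \sum_j (u *m A) 0 j * (u *m A)^T j 0 = \sum_j ((u *m A) 0 j) ^+ 2.
  by apply: eq_bigr => j _; rewrite [_^T _ _]mxE expr2.
move=> /eqP; rewrite psumr_eq0; last by move=> j _; exact: sqr_ge0.
move=> /allP H; have uA0 : u *m A = 0.
  apply/rowP => j; rewrite [RHS]mxE; apply/eqP; rewrite -sqrf_eq0.
  by apply: H; rewrite mem_index_enum.
by apply: (row_free_inj fA); rewrite uA0 mul0mx.
Qed.

(** Multiplying the equation by A^T gives t = b A^T (A A^T)^-1. Smoothness of the projection onto
    [Dp] and of [tangent_J], both known only through a pointwise equation, comes from here. *)
Lemma smooth_at_solve r m p (A : 'rV[R]_n -> 'M[R]_(r, m)) (b : 'rV[R]_n -> 'rV[R]_m)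
    (t : 'rV[R]_n -> 'rV[R]_r) :
  smooth_mx p A -> smooth_at p b ->
  (\forall q \near p, t q *m A q = b q /\ row_free (A q)) -> smooth_at p t.
Proof.
move=> sA sb H; have sA' := smooth_mx_tr sA.
have sG : smooth_mx p (fun q => A q *m (A q)^T) by exact: smooth_mxM.
have sb' : smooth_mx p b by move=> i j; rewrite ord1; move: j; apply/smooth_at_coordP.
have sI : smooth_mx p (fun q => invmx (A q *m (A q)^T)).
  by apply: smooth_mx_inv => //; apply: filterS H => q [_]; exact: row_free_gram.
apply: (@smooth_at_eq _ _ _ _ (fun q => (b q *m (A q)^T) *m invmx (A q *m (A q)^T))).
  apply: filterS H => q [<- fA]; rewrite -(mulmxA (t q)) -mulmxA mulmxV ?mulmx1//.
  exact: row_free_gram.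
by apply/smooth_at_coordP => j; apply: (smooth_mxM (smooth_mxM sb' sA') sI).
Qed.

End DiffRules.

(** * Charts *)

(* A device to treat scalar and vector valued functions on manifolds at once. *)
Definition smooth_comp_closed (R : realType) (V : normedModType R) :=
  forall n m p (g : 'rV[R]_n -> 'rV[R]_m) (h : 'rV[R]_m -> V),
    smooth_at p g -> smooth_at (g p) h -> smooth_at p (h \o g).

Lemma scalar_comp_closed (R : realType) : @smooth_comp_closed R R^o.
Proof. by move=> n m p g h; exact: smooth_at_comp_scalar. Qed.

Lemma row_comp_closed (R : realType) l : @smooth_comp_closed R 'rV[R]_l.
Proof. by move=> n m p g h; exact: smooth_at_comp. Qed.

(** [cpsi] inverts [cphi] only on the chart domain, so a factorisation through another chart holds
    only near [p], and its base point is known only up to a proved equation. *)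
Lemma diff_chain_near (R : realType) n m (V : normedModType R) (p : 'rV[R]_n)
    (q : 'rV[R]_m) (f : 'rV[R]_n -> V) (g : 'rV[R]_n -> 'rV[R]_m)
    (h : 'rV[R]_m -> V) v :
  smooth_at p g -> smooth_at q h -> g p = q -> (\near p, f p = h (g p)) ->
  'd f p v = 'd h q ('d g p v).
Proof.
move=> /smooth_at_differentiable dg /smooth_at_differentiable dh gpq e; subst q.
have dhg := differentiable_comp dg dh.
have e' : \near p, (h \o g) p = f p by apply: filterS e => r ->.
have [_ E] := near_eq_is_diff e' dhg.
by rewrite E (diff_comp dg dh).
Qed.

Section Charts.
Variables (R : realType) (n : nat) (M : manifold R n).
Implicit Types (c k : chart R n M) (x y : M) (O : set M).

Lemma cdom_near c x : cdom c x -> \forall y \near x, cdom c y.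
Proof. by move=> cx; exact: (open_nbhs_nbhs (conj (@cdom_open _ _ _ c) cx)). Qed.

Lemma cpsi_cont c x : cdom c x -> {for cphi c x, continuous (cpsi c)}.
Proof.
move=> cx; have := @cpsi_continuous _ _ _ c.
rewrite continuous_open_subspace; last exact: cimg_open.
by apply; rewrite inE; exists x.
Qed.

Lemma near_cpsi c x (P : set M) : cdom c x ->
  (\forall y \near x, P y) -> \forall p \near cphi c x, P (cpsi c p).
Proof.
move=> cx nP; have cc := cpsi_cont cx.
by apply: (cc P); rewrite cphiK.
Qed.

Lemma near_cpsiK c x : cdom c x ->
  \forall p \near cphi c x, cdom c (cpsi c p) /\ cphi c (cpsi c p) = p.
Proof.
move=> cx; have oI := @cimg_open _ _ _ c.
have nI : nbhs (cphi c x) (cphi c @` cdom c).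
  by apply: open_nbhs_nbhs; split => //; exists x.
apply: filterS nI.
by move=> _ [y cy <-]; rewrite cphiK.
Qed.

Lemma chart_img_open c O : open O -> open (cphi c @` (cdom c `&` O)).
Proof.
move=> oO; rewrite openE => _ [x [cx Ox] <-].
have nO : \forall y \near x, O y by exact: open_nbhs_nbhs.
apply: filterS (filterI (near_cpsiK cx) (near_cpsi cx nO)) => p [[cp pK] Op].
by exists (cpsi c p).
Qed.

Lemma smooth_at_transition c c' x : atlas M c -> atlas M c' ->
  cdom c x -> cdom c' x -> smooth_at (cphi c x) (cphi c' \o cpsi c).
Proof.
move=> ac ac' cx cx'; exists (cphi c @` (cdom c `&` cdom c')).
  by split; [apply: chart_img_open; exact: cdom_open|exists x].
exact: atlas_compat.
Qed.

Definition smooth_in (V : normedModType R) c x (h : M -> V) :=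
  smooth_at (cphi c x) (h \o cpsi c).

Lemma smooth_in_eq (V : normedModType R) c x (h h' : M -> V) : cdom c x ->
  (\forall y \near x, h y = h' y) -> smooth_in c x h -> smooth_in c x h'.
Proof. by move=> cx e sh; apply: smooth_at_eq sh; exact: (near_cpsi cx e). Qed.

Lemma smooth_in_chart (V : normedModType R) c c' x (h : M -> V) :
  smooth_comp_closed V -> atlas M c -> atlas M c' -> cdom c x -> cdom c' x ->
  smooth_in c x h -> smooth_in c' x h.
Proof.
move=> cV ac ac' cx cx' sh.
apply: (@smooth_at_eq _ _ _ _ ((h \o cpsi c) \o (cphi c \o cpsi c'))).
  apply: filterS (near_cpsi cx' (cdom_near cx)) => p cp /=.
  by rewrite cphiK.
by apply: cV; [exact: smooth_at_transition|rewrite /= cphiK].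
Qed.

(** [smooth_fun] quantifies over the whole atlas; as transition maps are smooth, the preferred chart
    at each point decides. *)
Lemma smooth_funP (V : normedModType R) O (h : M -> V) :
  smooth_comp_closed V -> open O ->
  smooth_fun O h <-> forall x, O x -> smooth_in (chart_at x) x h.
Proof.
move=> cV oO; split=> [sh x Ox|H c ac].
  exists (cphi (chart_at x) @` (cdom (chart_at x) `&` O)); last first.
    exact: sh (chart_at_atlas x).
  split; first exact: chart_img_open.
  by exists x => //; split => //; exact: chart_at_dom.
apply: smooth_at_smooth => _ [x [cx Ox] <-].
apply: (@smooth_in_chart V (chart_at x)) => //; last exact: H.
- exact: chart_at_atlas.
- exact: chart_at_dom.
Qed.

Lemma tcoord_linear c x : linear (tcoord c x).
Proof. by move=> a u v; rewrite /tcoord linearP. Qed.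

HB.instance Definition _ c x := GRing.isLinear.Build R 'rV[R]_n 'rV[R]_n *:%R
  (tcoord c x) (@tcoord_linear c x).

Lemma der_linear (V : normedModType R) (h : M -> V) x : linear (der h x).
Proof. by move=> a u v; rewrite /der linearP. Qed.

HB.instance Definition _ (V : normedModType R) (h : M -> V) x :=
  GRing.isLinear.Build R 'rV[R]_n V *:%R (der h x) (@der_linear V h x).

Lemma tcoord_change c c' x v : atlas M c -> atlas M c' -> cdom c x -> cdom c' x ->
  tcoord c' x v = 'd (cphi c' \o cpsi c) (cphi c x) (tcoord c x v).
Proof.
move=> ac ac' cx cx'; have kx := chart_at_dom x; have ak := chart_at_atlas x.
have s1 := smooth_at_transition ak ac kx cx.
have s2 := smooth_at_transition ac ac' cx cx'.
apply: (diff_chain_near v s1 s2); first by rewrite /= cphiK.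
by apply: filterS (near_cpsi kx (cdom_near cx)) => p cp /=; rewrite cphiK.
Qed.

Lemma diff_transition_id c x v : cdom c x ->
  'd (cphi c \o cpsi c) (cphi c x) v = v.
Proof.
move=> cx; have dK : differentiable (id : 'rV[R]_n -> 'rV[R]_n) (cphi c x).
  exact: ex_diff.
have e : \forall p \near cphi c x, id p = (cphi c \o cpsi c) p.
  by apply: filterS (near_cpsiK cx) => p [_ pK] /=; rewrite pK.
by have [_ ->] := near_eq_is_diff e dK; rewrite diff_val.
Qed.

Lemma tcoord_self x v : tcoord (chart_at x) x v = v.
Proof. by apply: diff_transition_id; exact: chart_at_dom. Qed.

(** The local field with constant components [v] in [c]; basis vectors give [coord_vf]. It inverts
    [tcoord c x] and serves to extend a single vector to a field. *)
Definition cfield c (v : 'rV[R]_n) x : 'rV[R]_n :=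
  'd (cphi (chart_at x) \o cpsi c) (cphi c x) v.

Lemma cfieldK c v x : atlas M c -> cdom c x -> tcoord c x (cfield c v x) = v.
Proof.
move=> ac cx; have kx := chart_at_dom x; have ak := chart_at_atlas x.
have s1 := smooth_at_transition ac ak cx kx.
have s2 := smooth_at_transition ak ac kx cx.
rewrite -[RHS](diff_transition_id v cx); apply/esym.
apply: (diff_chain_near v s1 s2); first by rewrite /= cphiK.
by apply: filterS (near_cpsi cx (cdom_near kx)) => p cp /=; rewrite cphiK.
Qed.

Lemma tcoordK c v x : atlas M c -> cdom c x -> cfield c (tcoord c x v) x = v.
Proof.
move=> ac cx; have kx := chart_at_dom x; have ak := chart_at_atlas x.
rewrite /cfield -(tcoord_change v ac ak cx kx); exact: tcoord_self.
Qed.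

Lemma tcoord_inj c x : atlas M c -> cdom c x -> injective (tcoord c x).
Proof. by move=> ac cx u v e; rewrite -(tcoordK u ac cx) e tcoordK. Qed.

Lemma tcoord_frame c v x : atlas M c -> cdom c x ->
  v = \sum_i tcoord c x v 0 i *: coord_vf c i x.
Proof.
move=> ac cx; rewrite -[LHS](tcoordK v ac cx) /cfield diff_sum_coord.
by [].
Qed.

End Charts.

(** * Vector fields and connections *)

Section VectorFields.
Variables (R : realType) (n : nat) (M : manifold R n).
Implicit Types (c k : chart R n M) (x y : M) (O : set M) (X Y Z : M -> 'rV[R]_n).

Definition vsmooth_in c x X := smooth_in c x (fun y => tcoord c y (X y)).

Lemma vsmooth_in_chart c c' x X : atlas M c -> atlas M c' ->
  cdom c x -> cdom c' x -> vsmooth_in c x X -> vsmooth_in c' x X.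
Proof.
move=> ac ac' cx cx' sX.
apply: (smooth_in_chart (@row_comp_closed R n) ac ac' cx cx').
have s1 := smooth_at_diffapp (smooth_at_transition ac ac' cx cx') sX.
apply: smooth_at_eq s1.
apply: filterS (filterI (near_cpsiK cx) (near_cpsi cx (cdom_near cx'))).
move=> p [[cp pK] cp'] /=.
by rewrite (tcoord_change _ ac ac' cp cp') pK.
Qed.

Lemma smooth_vfP O X : open O ->
  smooth_vf O X <-> forall x, O x -> vsmooth_in (chart_at x) x X.
Proof.
move=> oO; split=> [sX x Ox|H c ac].
  have := sX _ (chart_at_atlas x).
  move=> /(smooth_funP _ (@row_comp_closed R n) (openI oO (@cdom_open _ _ _ _))).
  by apply; split => //; exact: chart_at_dom.
apply/(smooth_funP _ (@row_comp_closed R n) (openI oO (@cdom_open _ _ _ c))).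
move=> x [Ox cx]; have ak := chart_at_atlas x; have kx := chart_at_dom x.
apply: (smooth_in_chart (@row_comp_closed R n) ac ak cx kx).
by apply: (vsmooth_in_chart ak ac kx cx); exact: H.
Qed.

Lemma smooth_vf_in O X c x : open O -> smooth_vf O X -> O x -> atlas M c -> cdom c x ->
  vsmooth_in c x X.
Proof.
move=> oO /(smooth_vfP _ oO) sX Ox ac cx.
apply: (vsmooth_in_chart (chart_at_atlas x) ac (chart_at_dom x) cx); exact: sX.
Qed.

Lemma smooth_fun_sub (V : normedModType R) O O' (h : M -> V) : O' `<=` O ->
  smooth_fun O h -> smooth_fun O' h.
Proof.
move=> OO' sh c ac k; apply: Ck_sub (sh c ac k).
by move=> _ [x [cx Ox] <-]; exists x => //; split => //; exact: OO'.
Qed.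

Lemma smooth_vf_sub O O' X : O' `<=` O -> smooth_vf O X -> smooth_vf O' X.
Proof.
move=> OO' sX c ac; apply: smooth_fun_sub (sX c ac).
by move=> x [/OO' Ox cx].
Qed.

Lemma vsmooth_in_eq c x X Y : cdom c x -> (\forall y \near x, X y = Y y) ->
  vsmooth_in c x X -> vsmooth_in c x Y.
Proof.
move=> cx e; apply: smooth_in_eq cx _.
by apply: filterS e => y ->.
Qed.

Lemma smooth_vf_eq O X Y : open O -> (forall x, O x -> X x = Y x) ->
  smooth_vf O X -> smooth_vf O Y.
Proof.
move=> oO e /(smooth_vfP _ oO) sX; apply/smooth_vfP => // x Ox.
have n0 : \forall y \near x, X y = Y y.
  by apply: filterS (open_nbhs_nbhs (conj oO Ox)).
exact: vsmooth_in_eq (chart_at_dom x) n0 (sX x Ox).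
Qed.

Lemma vsmooth_inZ c x (h : M -> R^o) X : smooth_in c x h -> vsmooth_in c x X ->
  vsmooth_in c x (fun y => (h y : R) *: X y).
Proof.
move=> sh sX; apply: smooth_at_ext (smooth_atZ sh sX) => p /=.
by rewrite linearZ.
Qed.

Lemma vsmooth_in_sum c x (I : Type) (r : seq I) (X : I -> M -> 'rV[R]_n) :
  (forall i, vsmooth_in c x (X i)) -> vsmooth_in c x (fun y => \sum_(i <- r) X i y).
Proof.
move=> sX; apply: (@smooth_at_ext _ _ _ _ (fun p => \sum_(i <- r) tcoord c (cpsi c p) (X i (cpsi c p)))).
  by move=> p /=; rewrite linear_sum.
by apply: smooth_at_sum => i _; exact: sX.
Qed.

Lemma smooth_vf_cfield c v : atlas M c -> smooth_vf (cdom c) (cfield c v).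
Proof.
move=> ac; apply/(smooth_vfP _ (@cdom_open _ _ _ c)) => x cx.
apply: (vsmooth_in_chart ac (chart_at_atlas x) cx (chart_at_dom x)).
apply: smooth_at_eq (smooth_at_cst _ v).
apply: filterS (near_cpsiK cx) => p [cp _] /=.
by rewrite cfieldK.
Qed.

Lemma smooth_vf_coord c i : atlas M c -> smooth_vf (cdom c) (coord_vf c i).
Proof. exact: smooth_vf_cfield. Qed.

Lemma smooth_fun_coord O Y c i : open O -> smooth_vf O Y -> atlas M c ->
  smooth_fun (O `&` cdom c) (fun y => tcoord c y (Y y) 0 i : R^o).
Proof.
move=> oO sY ac; have oOc := openI oO (@cdom_open _ _ _ c).
apply/(smooth_funP _ (@scalar_comp_closed R) oOc) => x [Ox cx].
apply: (smooth_in_chart (@scalar_comp_closed R) ac (chart_at_atlas x) cx (chart_at_dom x)).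
have /smooth_at_coordP sc := smooth_vf_in oO sY Ox ac cx.
exact: sc.
Qed.

End VectorFields.

(** * Locality and coordinate expression of a connection *)

Section Connections.
Variables (R : realType) (n : nat) (M : manifold R n) (nb : connection_op M).
Hypothesis cnb : connection nb.
Implicit Types (c k : chart R n M) (x y : M) (O : set M) (X Y Z : M -> 'rV[R]_n).

(* The indicator function of O is smooth on O, and multiplying by it makes Y and
   Z equal everywhere: the Leibniz rule then gives the locality. *)
Lemma nabla_local O x v Y Z : open O -> smooth_vf O Y -> O x ->
  (forall y, O y -> Y y = Z y) -> nb x v Y = nb x v Z.
Proof.
move=> oO sY Ox e; have sZ := smooth_vf_eq oO e sY.
pose h y : R := if pselect (O y) then 1 else 0.
have hO y : O y -> h y = 1 by rewrite /h; case: pselect.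
have sh : smooth_fun O (h : M -> R^o).
  apply/(smooth_funP _ (@scalar_comp_closed R) oO) => y Oy.
  have nO : \forall z \near y, (cst 1 : M -> R^o) z = h z.
    by apply: filterS (open_nbhs_nbhs (conj oO Oy)) => z /hO ->.
  by apply: smooth_in_eq (chart_at_dom y) nO _; exact: smooth_at_cst.
have := nabla_leibniz cnb oO sh sY Ox v.
rewrite (_ : (fun y => h y *: Y y) = fun y => h y *: Z y); last first.
  apply/funext => y; rewrite /h; case: (pselect (O y)) => [Oy|nOy].
    by rewrite (e _ Oy).
  by rewrite !scale0r.
rewrite (nabla_leibniz cnb oO sh sZ Ox v) (hO _ Ox) !scale1r (e _ Ox).
by move=> /addrI.
Qed.

Lemma nabla_zero x v : nb x v (fun=> 0) = 0.
Proof.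
have s0 : smooth_vf setT (fun _ : M => 0 : 'rV[R]_n).
  apply/(smooth_vfP _ openT) => y _; apply: smooth_at_ext (smooth_at_cst _ 0) => p.
  by rewrite /= linear0.
have := nabla_additive cnb openT s0 s0 (I : setT x) v.
rewrite (_ : (fun y => 0 + 0) = (fun=> 0)); last by apply/funext => y; rewrite addr0.
by move=> e; apply: (addrI (nb x v (fun=> 0))); rewrite -e addr0.
Qed.

Lemma smooth_vf_sum O (I : Type) (r : seq I) (Y : I -> M -> 'rV[R]_n) : open O ->
  (forall i, smooth_vf O (Y i)) -> smooth_vf O (fun y => \sum_(i <- r) Y i y).
Proof.
move=> oO sY; apply/smooth_vfP => // x Ox; apply: vsmooth_in_sum => i.
by have /(smooth_vfP _ oO) := sY i; exact.
Qed.

Lemma nabla_sum O x v (I : Type) (r : seq I) (Y : I -> M -> 'rV[R]_n) : open O ->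
  (forall i, smooth_vf O (Y i)) -> O x ->
  nb x v (fun y => \sum_(i <- r) Y i y) = \sum_(i <- r) nb x v (Y i).
Proof.
move=> oO sY Ox; elim: r => [|i r IH].
  rewrite big_nil -[RHS](nabla_zero x v); congr (nb x v _).
  by apply/funext => y; rewrite big_nil.
rewrite big_cons -IH -(nabla_additive cnb oO (sY i) (smooth_vf_sum r oO sY) Ox).
by congr (nb x v _); apply/funext => y; rewrite big_cons.
Qed.

Lemma smooth_vfZ O (h : M -> R) Y : open O -> smooth_fun O (h : M -> R^o) ->
  smooth_vf O Y -> smooth_vf O (fun y => h y *: Y y).
Proof.
move=> oO /(smooth_funP _ (@scalar_comp_closed R) oO) sh /(smooth_vfP _ oO) sY.
apply/smooth_vfP => // x Ox; apply: (@vsmooth_inZ _ _ _ _ _ (h : M -> R^o)); [exact: sh|exact: sY].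
Qed.

(** The Leibniz rule on the expansion of [Y] in the coordinate frame gives the derivative of the
    components plus the Christoffel terms. The expansion holds on the chart domain only, whence the
    use of [nabla_local]. *)
Lemma nabla_coord O x v Y : open O -> smooth_vf O Y -> O x ->
  nb x v Y = der (fun y => tcoord (chart_at x) y (Y y)) x v +
             \sum_i Y x 0 i *: nb x v (coord_vf (chart_at x) i).
Proof.
move=> oO sY Ox; set c := chart_at x.
have ac : atlas M c by exact: chart_at_atlas.
have cx : cdom c x by exact: chart_at_dom.
have oOc := openI oO (@cdom_open _ _ _ c).
pose O' := O `&` cdom c.
have sY' : smooth_vf O' Y by apply: smooth_vf_sub sY; exact: subIsetl.
have sE i : smooth_vf O' (coord_vf c i).
  by apply: smooth_vf_sub (smooth_vf_coord i ac); exact: subIsetr.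
have sh i := smooth_fun_coord i oO sY ac.
have O'x : O' x by [].
have e y : O' y -> Y y = \sum_i tcoord c y (Y y) 0 i *: coord_vf c i y.
  by move=> [_ cy]; exact: tcoord_frame.
rewrite (nabla_local v oOc sY' O'x e).
rewrite (nabla_sum v _ oOc _ O'x); last by move=> i; apply: smooth_vfZ.
have sv : vsmooth_in c x Y by exact: smooth_vf_in oO sY Ox ac cx.
rewrite [der _ _ _]row_sum_coord -big_split /=; apply: eq_bigr => i _.
have lei := nabla_leibniz cnb oOc (sh i) (sE i) O'x v.
apply: (etrans lei); rewrite tcoord_self; congr (_ *: _ + _).
  exact: esym (diff_coord v i sv).
exact: etrans (esym (tcoord_self _ _)) (cfieldK _ ac cx).
Qed.

End Connections.

(** * Vector fields along a map *)

Section AlongMap.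
Variables (R : realType) (m n : nat) (M : manifold R m) (N : manifold R n).
Variables (f : M -> N).
Hypothesis sf : smooth_map f.
Implicit Types (k : chart R m M) (c : chart R n N) (x y : M).
Implicit Types (X Y Z : M -> 'rV[R]_m) (P Q : M -> 'rV[R]_n).

Lemma smooth_map_continuous x : {for x, continuous f}.
Proof. by case: sf => cf _; exact: cf. Qed.

Lemma near_smooth_map x (S : set N) : (\forall z \near f x, S z) -> \forall y \near x, S (f y).
Proof. by move=> nS; have cf := @smooth_map_continuous x; exact: (cf S). Qed.

Lemma smooth_in_map k c x : atlas M k -> atlas N c -> cdom k x -> cdom c (f x) ->
  smooth_in k x (cphi c \o f).
Proof.
move=> ak ac kx cx; have [cf sfc] := sf.
have oO : open (f @^-1` cdom c).
  by apply: open_comp => [y _|]; [exact: smooth_map_continuous|exact: cdom_open].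
have /(smooth_funP _ (@row_comp_closed R n) oO) H := sfc c ac.
exact: (smooth_in_chart (@row_comp_closed R n) (chart_at_atlas x) ak (chart_at_dom x) kx (H x cx)).
Qed.

Lemma smooth_in_comp (V : normedModType R) k c x (h : N -> V) :
  smooth_comp_closed V -> atlas M k -> atlas N c -> cdom k x -> cdom c (f x) ->
  smooth_in c (f x) h -> smooth_in k x (h \o f).
Proof.
move=> cV ak ac kx cx sh; have sF := smooth_in_map ak ac kx cx.
have E : (cphi c \o f \o cpsi k) (cphi k x) = cphi c (f x) by rewrite /= cphiK.
have := cV _ _ _ (cphi c \o f \o cpsi k) (h \o cpsi c) sF.
rewrite E => /(_ sh) H; apply: smooth_at_eq H.
apply: filterS (near_cpsi kx (near_smooth_map (cdom_near cx))) => p /= cfp.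
by rewrite cphiK.
Qed.

Lemma dmapE x v : dmap f x v = der (cphi (chart_at (f x)) \o f) x v.
Proof. by rewrite /dmap lfunE. Qed.

Lemma der_comp (V : normedModType R) (h : N -> V) x v :
  smooth_in (chart_at (f x)) (f x) h ->
  der (h \o f) x v = der h (f x) (dmap f x v).
Proof.
move=> sh; rewrite dmapE; have kx := chart_at_dom x; have cx := chart_at_dom (f x).
have sF := smooth_in_map (chart_at_atlas x) (chart_at_atlas (f x)) kx cx.
apply: (diff_chain_near v sF sh); first by rewrite /= cphiK.
by apply: filterS (near_cpsi kx (near_smooth_map (cdom_near cx))) => p /= cfp; rewrite cphiK.
Qed.

(** [dmap] is defined with the preferred charts; the transition maps at source and target carry it
    to arbitrary ones. *)
Lemma tcoord_dmap k c x v : atlas M k -> atlas N c -> cdom k x -> cdom c (f x) ->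
  tcoord c (f x) (dmap f x v) =
  'd (cphi c \o f \o cpsi k) (cphi k x) (tcoord k x v).
Proof.
move=> ak ac kx cx.
have kx0 := chart_at_dom x; have cx0 := chart_at_dom (f x).
have ak0 := chart_at_atlas x; have ac0 := chart_at_atlas (f x).
have s00 := smooth_in_map ak0 ac0 kx0 cx0.
have s := smooth_in_map ak ac kx cx.
have sc := smooth_at_transition ac0 ac cx0 cx.
have sk := smooth_at_transition ak0 ak kx0 kx.
transitivity ('d (cphi c \o f \o cpsi (chart_at x)) (cphi (chart_at x) x) v).
  rewrite dmapE; apply/esym; apply: (diff_chain_near v s00 sc); first by rewrite /= cphiK.
  by apply: filterS (near_cpsi kx0 (near_smooth_map (cdom_near cx0))) => p /= cfp; rewrite cphiK.
apply: (diff_chain_near v sk s); first by rewrite /= cphiK.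
by apply: filterS (near_cpsi kx0 (cdom_near kx)) => p /= cfp; rewrite cphiK.
Qed.

Definition along_smooth k c x P := smooth_in k x (fun y => tcoord c (f y) (P y)).

Lemma along_smooth_eq k c x P Q : cdom k x -> (\forall y \near x, P y = Q y) ->
  along_smooth k c x P -> along_smooth k c x Q.
Proof.
by move=> kx e; apply: smooth_in_eq kx _; apply: filterS e => y ->.
Qed.

Lemma push_coord k c x Y : atlas M k -> atlas N c -> cdom k x -> cdom c (f x) ->
  \forall p \near cphi k x,
    'd (cphi c \o f \o cpsi k) p (tcoord k (cpsi k p) (Y (cpsi k p))) =
    tcoord c (f (cpsi k p)) (push f Y (cpsi k p)).
Proof.
move=> ak ac kx cx.
apply: filterS (filterI (near_cpsiK kx) (near_cpsi kx (near_smooth_map (cdom_near cx)))).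
move=> p [[kp pK] cp].
by rewrite /push (tcoord_dmap _ ak ac kp cp) pK.
Qed.

Lemma along_smooth_push k c x Y : atlas M k -> atlas N c -> cdom k x -> cdom c (f x) ->
  vsmooth_in k x Y -> along_smooth k c x (push f Y).
Proof.
move=> ak ac kx cx sY.
exact: smooth_at_eq (push_coord Y ak ac kx cx)
  (smooth_at_diffapp (smooth_in_map ak ac kx cx) sY).
Qed.

Lemma smooth_end_frame O (S : N -> 'End('rV[R]_n)) c z i : open O -> smooth_end O S ->
  atlas N c -> O z -> cdom c z -> vsmooth_in c z (fun z => S z (coord_vf c i z)).
Proof.
move=> oO sS ac Oz cz.
exact: (smooth_vf_in (openI oO (@cdom_open _ _ _ c)) (sS c i ac) (conj Oz cz) ac cz).
Qed.

Lemma End_coord (S : N -> 'End('rV[R]_n)) k c x P : atlas N c -> cdom k x -> cdom c (f x) ->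
  \forall y \near x,
    \sum_i tcoord c (f y) (P y) 0 i *: tcoord c (f y) (S (f y) (coord_vf c i (f y))) =
    tcoord c (f y) (S (f y) (P y)).
Proof.
move=> ac kx cx; apply: filterS (near_smooth_map (cdom_near cx)) => y cy.
rewrite {2}(tcoord_frame (P y) ac cy) !linear_sum; apply: eq_bigr => i _.
by rewrite !linearZ.
Qed.

Lemma along_smooth_End O (S : N -> 'End('rV[R]_n)) k c x P : open O -> smooth_end O S ->
  atlas M k -> atlas N c -> cdom k x -> cdom c (f x) -> O (f x) ->
  along_smooth k c x P -> along_smooth k c x (fun y => S (f y) (P y)).
Proof.
move=> oO sS ak ac kx cx Ofx sP; apply: (smooth_in_eq kx (End_coord S P ac kx cx)).
apply: smooth_at_sum => i _; apply: smooth_atZ.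
  by have /smooth_at_coordP sPi := sP; exact: sPi.
have sE := smooth_end_frame i oO sS ac Ofx cx.
exact: (smooth_in_comp (@row_comp_closed R n) ak ac kx cx sE).
Qed.

Section Nabla.
Variables (nb : connection_op N) (cnb : connection nb).

Lemma nabla_alongE x v P :
  along_smooth (chart_at x) (chart_at (f x)) x P ->
  nabla_along f nb x v P = der (fun y => tcoord (chart_at (f x)) (f y) (P y)) x v +
   \sum_i P x 0 i *: nb (f x) (dmap f x v) (coord_vf (chart_at (f x)) i).
Proof.
move=> sP; rewrite [der _ _ _]row_sum_coord /nabla_along -big_split.
apply: eq_bigr => i _; rewrite tcoord_self; congr (_ *: _ + _).
  exact: esym (diff_coord v i sP).
apply: etrans (esym (tcoord_self _ _)) _.
by apply: cfieldK; [exact: chart_at_atlas|exact: chart_at_dom].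
Qed.

Lemma coord_vf_self (z : N) i : coord_vf (chart_at z) i z = delta_mx 0 i.
Proof.
apply: etrans (esym (tcoord_self _ _)) _.
by apply: cfieldK; [exact: chart_at_atlas|exact: chart_at_dom].
Qed.

(** In the expansion of [P] in a frame, the terms that differentiate its components commute with
    [S]. The defect is thus tensorial and may be read off the coordinate frame, whose members are
    fields of N, where parallelism of sigma is available. *)
Lemma nabla_along_End O (S T : N -> 'End('rV[R]_n)) x v P : open O -> smooth_end O S ->
  O (f x) -> along_smooth (chart_at x) (chart_at (f x)) x P ->
  (forall i, nb (f x) (dmap f x v) (fun z => S z (coord_vf (chart_at (f x)) i z)) -
     S (f x) (nb (f x) (dmap f x v) (coord_vf (chart_at (f x)) i)) =
     T (f x) (coord_vf (chart_at (f x)) i (f x))) ->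
  nabla_along f nb x v (fun y => S (f y) (P y)) =
  S (f x) (nabla_along f nb x v P) + T (f x) (P x).
Proof.
move=> oO sS Ofx sP HT; set c := chart_at (f x); set k := chart_at x.
have ak : atlas M k := chart_at_atlas x; have ac : atlas N c := chart_at_atlas (f x).
have kx : cdom k x := chart_at_dom x; have cx : cdom c (f x) := chart_at_dom (f x).
have sSP := along_smooth_End oO sS ak ac kx cx Ofx sP.
have sE i := smooth_end_frame i oO sS ac Ofx cx.
have sEf i := smooth_in_comp (@row_comp_closed R n) ak ac kx cx (sE i).
have sPi i : smooth_in k x (fun y => tcoord c (f y) (P y) 0 i : R^o).
  by have /smooth_at_coordP sPi := sP; exact: sPi.
rewrite (nabla_alongE v sSP) (nabla_alongE v sP) -/c.
set w := dmap f x v.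
pose dp := der (fun y => tcoord c (f y) (P y)) x v.
pose E i := coord_vf c i.
have Ei i : E i (f x) = delta_mx 0 i by exact: coord_vf_self.
pose ds i := der (fun z => tcoord c z (S z (E i z))) (f x) w.
(* Product rule on S P, the sum of the P_i S E_i; the derivative of S E_i along [f] is its
   derivative on N in the direction df v. *)
have e1 : der (fun y => tcoord c (f y) (S (f y) (P y))) x v =
  \sum_i (dp 0 i *: S (f x) (E i (f x)) + P x 0 i *: ds i).
  have ssum : smooth_in k x (fun y => \sum_i tcoord c (f y) (P y) 0 i *: tcoord c (f y) (S (f y) (E i (f y)))).
    by apply: smooth_at_sum => i _; apply: smooth_atZ; [exact: sPi|exact: sEf].
  have e := smooth_at_near_diff ssum (near_cpsi kx (End_coord S P ac kx cx)).
  apply: (etrans (esym (congr1 (@^~ v) e))).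
  have e2 := diff_sumE (index_enum 'I_n) v (fun i => smooth_atZ (sPi i) (sEf i)).
  apply: (etrans e2); apply: eq_bigr => i _.
  apply: (etrans (diff_scaleE v (sPi i) (sEf i))).
  congr (_ *: _ + _ *: _).
  - exact: esym (diff_coord v i sP).
  - exact: etrans (congr1 (fun y => tcoord c (f y) (S (f y) (E i (f y)))) (cphiK kx))
      (tcoord_self _ _).
  - exact: etrans (congr1 (fun y => tcoord c (f y) (P y) 0 i) (cphiK kx))
      (congr1 (fun z : 'rV[R]_n => z 0 i) (tcoord_self _ _)).
  - exact: (der_comp v (sE i)).
have e2 i : nb (f x) w (fun z => S z (E i z)) =
    ds i + \sum_l S (f x) (E i (f x)) 0 l *: nb (f x) w (E l).
  exact: (nabla_coord cnb w (openI oO (@cdom_open _ _ _ c)) (sS c i ac) (conj Ofx cx)).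
(* The Christoffel terms of S P are regrouped by the components of P, to match those supplied by
   [e2]. *)
have e3 : \sum_l (S (f x) (P x)) 0 l *: nb (f x) w (E l) =
    \sum_i P x 0 i *: \sum_l S (f x) (E i (f x)) 0 l *: nb (f x) w (E l).
  rewrite {1}[P x]row_sum_coord linear_sum.
  under eq_bigr do rewrite summxE scaler_suml.
  rewrite exchange_big; apply: eq_bigr => i _; rewrite scaler_sumr.
  by apply: eq_bigr => l _; rewrite linearZ Ei mxE scalerA.
rewrite e1 e3 -big_split /=.
rewrite [X in T _ X]row_sum_coord [X in S _ (X + _)]row_sum_coord.
rewrite -big_split !linear_sum -big_split /=; apply: eq_bigr => i _.
rewrite -addrA -scalerDr -e2 linearD !linearZ /= -addrA; congr (_ *: S _ _ + _).
  exact: Ei.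
by rewrite -scalerDr -Ei -HT subrKC.
Qed.

End Nabla.
End AlongMap.

(** * The connection induced along a map *)

Section MetricAlgebra.
Variables (R : realType) (n : nat) (N : manifold R n) (g : tensor2 N).
Hypothesis rg : riemannian g.
Implicit Types (x : N) (u v w : 'rV[R]_n).

Lemma riemZl x a u w : g x (a *: u) w = a * g x u w.
Proof.
have e0 : g x 0 w = 0.
  have := riem_linear rg x 1 0 0 w; rewrite scaler0 addr0 mul1r => e.
  by apply: (addrI (g x 0 w)); rewrite -e addr0.
by have := riem_linear rg x a u 0 w; rewrite addr0 e0 addr0.
Qed.

Lemma riemDl x u v w : g x (u + v) w = g x u w + g x v w.
Proof. by have := riem_linear rg x 1 u v w; rewrite scale1r mul1r. Qed.

Lemma riem0l x w : g x 0 w = 0.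
Proof. by rewrite -(scale0r 0) riemZl mul0r. Qed.

Lemma riemNl x u w : g x (- u) w = - g x u w.
Proof. by rewrite -scaleN1r riemZl mulN1r. Qed.

Lemma riemBl x u v w : g x (u - v) w = g x u w - g x v w.
Proof. by rewrite riemDl riemNl. Qed.

Lemma riem_suml x (I : Type) (r : seq I) (F : I -> 'rV[R]_n) w :
  g x (\sum_(i <- r) F i) w = \sum_(i <- r) g x (F i) w.
Proof.
elim: r => [|i r IH]; first by rewrite !big_nil riem0l.
by rewrite !big_cons riemDl IH.
Qed.

Lemma riemZr x a u w : g x w (a *: u) = a * g x w u.
Proof. by rewrite !(riem_sym rg x w) riemZl. Qed.

Lemma riemDr x u v w : g x w (u + v) = g x w u + g x w v.
Proof. by rewrite !(riem_sym rg x w) riemDl. Qed.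

Lemma riemNr x u w : g x w (- u) = - g x w u.
Proof. by rewrite !(riem_sym rg x w) riemNl. Qed.

Lemma riem_sumr x (I : Type) (r : seq I) (F : I -> 'rV[R]_n) w :
  g x w (\sum_(i <- r) F i) = \sum_(i <- r) g x w (F i).
Proof.
by rewrite riem_sym// riem_suml; apply: eq_bigr => i _; rewrite riem_sym.
Qed.

Lemma riem_eq0 x u : g x u u = 0 -> u = 0.
Proof.
move=> e; apply/eqP/negPn/negP => u0.
by have := riem_pos rg x u0; rewrite e ltxx.
Qed.

(** With [a i] the covariant derivatives of the frame, the left side is g(nabla P, Q) + g(P, nabla
    Q), and the right side is the product rule for the sum of the P_i Q_j g_ij. *)
Lemma riem_leibniz_frame x (p q dp dq : 'rV[R]_n) (a : 'I_n -> 'rV[R]_n) :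
  g x (dp + \sum_i p 0 i *: a i) q + g x p (dq + \sum_i q 0 i *: a i) =
  \sum_i \sum_j ((dp 0 i * q 0 j + p 0 i * dq 0 j) *
      g x (delta_mx 0 i) (delta_mx 0 j) +
    p 0 i * q 0 j * (g x (a i) (delta_mx 0 j) + g x (delta_mx 0 i) (a j))).
Proof.
have H u v : g x u v = \sum_i \sum_j u 0 i * v 0 j * g x (delta_mx 0 i) (delta_mx 0 j).
  rewrite {1}[u]row_sum_coord riem_suml; apply: eq_bigr => i _.
  rewrite {1}[v]row_sum_coord riem_sumr; apply: eq_bigr => j _.
  by rewrite riemZl riemZr mulrA.
have H1 : g x (\sum_i p 0 i *: a i) q = \sum_i \sum_j p 0 i * q 0 j * g x (a i) (delta_mx 0 j).
  rewrite riem_suml; apply: eq_bigr => i _.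
  rewrite {1}[q]row_sum_coord riem_sumr; apply: eq_bigr => j _.
  by rewrite riemZl riemZr mulrA.
have H2 : g x p (\sum_i q 0 i *: a i) = \sum_i \sum_j p 0 i * q 0 j * g x (delta_mx 0 i) (a j).
  rewrite {1}[p]row_sum_coord riem_suml; apply: eq_bigr => i _.
  rewrite riem_sumr; apply: eq_bigr => j _.
  by rewrite riemZl riemZr mulrA.
rewrite riemDl riemDr (H dp q) (H p dq) H1 H2 -!big_split; apply: eq_bigr => i _.
rewrite -!big_split; apply: eq_bigr => j _ /=; ring.
Qed.

Lemma riem_smooth_in c x i j : atlas N c -> cdom c x ->
  smooth_in c x (fun z => g z (coord_vf c i z) (coord_vf c j z) : R^o).
Proof.
move=> ac cx; have sg := riem_smooth rg i j ac.
have /(smooth_funP _ (@scalar_comp_closed R) (@cdom_open _ _ _ c)) H := sg.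
exact: (smooth_in_chart (@scalar_comp_closed R) (chart_at_atlas x) ac (chart_at_dom x) cx (H x cx)).
Qed.

End MetricAlgebra.

(** * The induced connection is torsion free and metric *)

Section Pullback.
Variables (R : realType) (m n : nat) (M : manifold R m) (N : manifold R n).
Variables (f : M -> N) (g : tensor2 N) (nb : connection_op N).
Hypotheses (sf : smooth_map f) (rg : riemannian g) (lc : levi_civita g nb).
Implicit Types (x y : M) (W : set M) (k : chart R m M) (c : chart R n N).
Implicit Types (X Y Z : M -> 'rV[R]_m) (P Q : M -> 'rV[R]_n).

Let cnb := lc_connection lc.

(** Coordinate fields have constant components in their own chart, so their bracket vanishes: this
    is the symmetry of the Christoffel symbols. *)
Lemma nabla_coord_vf_sym (z : N) i j :
  nb z (delta_mx 0 j) (coord_vf (chart_at z) i) =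
  nb z (delta_mx 0 i) (coord_vf (chart_at z) j).
Proof.
set c := chart_at z; have ac : atlas N c := chart_at_atlas z.
have cz : cdom c z := chart_at_dom z.
have E l : coord_vf c l z = delta_mx 0 l by exact: coord_vf_self.
have := lc_torsion_free lc (@cdom_open _ _ _ c) (smooth_vf_coord j ac) (smooth_vf_coord i ac) cz.
rewrite !E => H; apply/eqP; rewrite -subr_eq0; apply/eqP; rewrite H.
have D0 l w : der (fun y : N => tcoord c y (coord_vf c l y)) z w = 0.
  have e : \forall p \near cphi c z,
      (fun _ : 'rV[R]_n => delta_mx 0 l : 'rV[R]_n) p = ((fun y : N => tcoord c y (coord_vf c l y)) \o cpsi c) p.
    apply: filterS (near_cpsiK cz) => p [cp _] /=; apply/esym.
    exact: (cfieldK (delta_mx 0 l) ac cp).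
  have := smooth_at_near_diff (smooth_at_cst _ _) e => /(congr1 (@^~ w)) e1.
  by apply: (etrans (esym e1)); exact: diff_cstE.
apply: (etrans (congr2 (fun a b => a - b) (D0 _ _) (D0 _ _))); exact: subrr.
Qed.

Lemma der_push W x v Y : open W -> smooth_vf W Y -> W x ->
  der (fun y => tcoord (chart_at (f x)) (f y) (push f Y y)) x v =
  'd (fun p => 'd (cphi (chart_at (f x)) \o f \o cpsi (chart_at x)) p (Y x))
     (cphi (chart_at x) x) v +
  dmap f x (der (fun y => tcoord (chart_at x) y (Y y)) x v).
Proof.
move=> oW sY Wx; set c := chart_at (f x); set k := chart_at x.
have ak : atlas M k := chart_at_atlas x; have ac : atlas N c := chart_at_atlas (f x).
have kx : cdom k x := chart_at_dom x; have cx : cdom c (f x) := chart_at_dom (f x).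
have sF := smooth_in_map sf ak ac kx cx.
have svY := smooth_vf_in oW sY Wx ak kx.
have sd := smooth_at_diffapp sF svY.
have e := smooth_at_near_diff sd (push_coord sf Y ak ac kx cx).
apply: (etrans (esym (congr1 (@^~ v) e))).
apply: (etrans (diff_diffapp v sF svY)).
have Yx : tcoord k (cpsi k (cphi k x)) (Y (cpsi k (cphi k x))) = Y x.
  exact: etrans (congr1 (fun y => tcoord k y (Y y)) (cphiK kx)) (tcoord_self _ _).
apply: (congr2 +%R); last exact: esym (dmapE _ _ _).
exact: (congr1 (fun z => 'd (fun p => 'd (cphi c \o f \o cpsi k) p z) (cphi k x) v) Yx).
Qed.

Lemma nabla_linear_sum (z : N) O (Y : N -> 'rV[R]_n) w : open O -> smooth_vf O Y -> O z ->
  nb z w Y = \sum_j w 0 j *: nb z (delta_mx 0 j) Y.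
Proof.
move=> oO sY Oz; have lin := nabla_linear cnb oO sY Oz.
have n0 : nb z 0 Y = 0.
  have := lin 1 0 0; rewrite scaler0 addr0 scale1r => e.
  by apply: (addrI (nb z 0 Y)); rewrite -e addr0.
rewrite {1}[w]row_sum_coord.
elim: (index_enum _) => [|i r IH]; first by rewrite !big_nil.
by rewrite !big_cons lin IH.
Qed.

(** Besides the second derivatives of [f], the Christoffel terms also cancel, being bilinear and
    symmetric in df X and df Y. What remains is df applied to the two terms of [lie]. *)
Lemma nabla_along_torsion W x X Y : open W -> smooth_vf W X -> smooth_vf W Y -> W x ->
  nabla_along f nb x (X x) (push f Y) - nabla_along f nb x (Y x) (push f X) =
  dmap f x (lie X Y x).
Proof.
move=> oW sX sY Wx; set c := chart_at (f x); set k := chart_at x.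
have ak : atlas M k := chart_at_atlas x; have ac : atlas N c := chart_at_atlas (f x).
have kx : cdom k x := chart_at_dom x; have cx : cdom c (f x) := chart_at_dom (f x).
have sPX := along_smooth_push sf ak ac kx cx (smooth_vf_in oW sX Wx ak kx).
have sPY := along_smooth_push sf ak ac kx cx (smooth_vf_in oW sY Wx ak kx).
rewrite (nabla_alongE _ _ sPX) (nabla_alongE _ _ sPY).
rewrite (der_push _ oW sX Wx) (der_push _ oW sY Wx).
have sF := smooth_in_map sf ak ac kx cx.
have H : 'd (fun p => 'd (cphi c \o f \o cpsi k) p (Y x)) (cphi k x) (X x) =
         'd (fun p => 'd (cphi c \o f \o cpsi k) p (X x)) (cphi k x) (Y x).
  exact: diff_comm.
have S : \sum_i push f Y x 0 i *: nb (f x) (dmap f x (X x)) (coord_vf c i) =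
         \sum_i push f X x 0 i *: nb (f x) (dmap f x (Y x)) (coord_vf c i).
  have e w i := nabla_linear_sum w (@cdom_open _ _ _ c) (smooth_vf_coord i ac) cx.
  under eq_bigr do rewrite e scaler_sumr.
  under [RHS]eq_bigr do rewrite e scaler_sumr.
  rewrite [RHS]exchange_big; apply: eq_bigr => i _; apply: eq_bigr => j _.
  by rewrite nabla_coord_vf_sym !scalerA mulrC.
rewrite S opprD addrACA subrr addr0 /lie linearB /=.
apply: (etrans (congr1 (fun z => z + _ - _) H)).
by rewrite opprD addrACA subrr add0r.
Qed.

Lemma metric_coord k c x P Q : atlas N c -> cdom k x -> cdom c (f x) ->
  \forall y \near x,
    \sum_i \sum_j tcoord c (f y) (P y) 0 i * tcoord c (f y) (Q y) 0 j *
       g (f y) (coord_vf c i (f y)) (coord_vf c j (f y)) =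
    g (f y) (P y) (Q y).
Proof.
move=> ac kx cx; apply: filterS (near_smooth_map sf (cdom_near cx)) => y cy.
rewrite [in RHS](tcoord_frame (P y) ac cy) (riem_suml rg); apply: eq_bigr => i _.
rewrite [in RHS](tcoord_frame (Q y) ac cy) (riem_sumr rg); apply: eq_bigr => j _.
by rewrite (riemZl rg) (riemZr rg) mulrA.
Qed.

Lemma along_smooth_coord k c x P i : along_smooth f k c x P ->
  smooth_in k x (fun y => tcoord c (f y) (P y) 0 i : R^o).
Proof. by move=> sP; have /smooth_at_coordP sPi := sP; exact: sPi. Qed.

Lemma smooth_in_metric k c x P Q : atlas M k -> atlas N c -> cdom k x -> cdom c (f x) ->
  along_smooth f k c x P -> along_smooth f k c x Q ->
  smooth_in k x (fun y => g (f y) (P y) (Q y) : R^o).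
Proof.
move=> ak ac kx cx sP sQ; apply: (smooth_in_eq kx (metric_coord P Q ac kx cx)).
apply: smooth_at_sum => i _; apply: smooth_at_sum => j _.
have sg := smooth_in_comp sf (@scalar_comp_closed R) ak ac kx cx (riem_smooth_in rg i j ac cx).
exact: smooth_atM (smooth_atM (along_smooth_coord i sP) (along_smooth_coord j sQ)) sg.
Qed.

(** Product rule on the sum of the P_i Q_j g_ij, with g_ij composed with [f]: its derivative along v
    is that of g_ij along df v, where metricity on N applies to the coordinate frame. *)
Lemma nabla_along_metric x v P Q :
  along_smooth f (chart_at x) (chart_at (f x)) x P ->
  along_smooth f (chart_at x) (chart_at (f x)) x Q ->
  der (fun y => g (f y) (P y) (Q y) : R^o) x v =
  g (f x) (nabla_along f nb x v P) (Q x) + g (f x) (P x) (nabla_along f nb x v Q).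
Proof.
move=> sP sQ; set c := chart_at (f x); set k := chart_at x.
have ak : atlas M k := chart_at_atlas x; have ac : atlas N c := chart_at_atlas (f x).
have kx : cdom k x := chart_at_dom x; have cx : cdom c (f x) := chart_at_dom (f x).
have sPi i := along_smooth_coord i sP; have sQj j := along_smooth_coord j sQ.
have sg i j := riem_smooth_in rg i j ac cx.
have sgf i j := smooth_in_comp sf (@scalar_comp_closed R) ak ac kx cx (sg i j).
rewrite (nabla_alongE _ _ sP) (nabla_alongE _ _ sQ) -/c.
set w := dmap f x v.
pose dp := der (fun y => tcoord c (f y) (P y)) x v.
pose dq := der (fun y => tcoord c (f y) (Q y)) x v.
pose E i := coord_vf c i.
have Ei i : E i (f x) = delta_mx 0 i by exact: coord_vf_self.
pose G i j := g (f x) (E i (f x)) (E j (f x)).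
pose dG i j := g (f x) (nb (f x) w (E i)) (E j (f x)) + g (f x) (E i (f x)) (nb (f x) w (E j)).
have sM i j := smooth_atM (sPi i) (sQj j).
have sMg i j := smooth_atM (sM i j) (sgf i j).
have cg (a a' b b' d d' e e' : R) : a = a' -> b = b' -> d = d' -> e = e' ->
    a * b + d * e = a' * b' + d' * e' by move=> -> -> -> ->.
have e1 : der (fun y => g (f y) (P y) (Q y) : R^o) x v =
   \sum_i \sum_j ((dp 0 i * Q x 0 j + P x 0 i * dq 0 j) * G i j + P x 0 i * Q x 0 j * dG i j).
  have ss i := smooth_at_sum (index_enum 'I_n) (P := xpredT) (fun j _ => sMg i j).
  have sss := smooth_at_sum (index_enum 'I_n) (P := xpredT) (fun i _ => ss i).
  have e := smooth_at_near_diff sss (near_cpsi kx (metric_coord P Q ac kx cx)).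
  apply: (etrans (esym (congr1 (@^~ v) e))).
  apply: (etrans (diff_sumE (index_enum 'I_n) v ss)); apply: eq_bigr => i _.
  apply: (etrans (diff_sumE (index_enum 'I_n) v (sMg i))); apply: eq_bigr => j _.
  have xx := cphiK kx.
  have px : tcoord c (f (cpsi k (cphi k x))) (P (cpsi k (cphi k x))) = P x.
    exact: etrans (congr1 (fun y => tcoord c (f y) (P y)) xx) (tcoord_self _ _).
  have qx : tcoord c (f (cpsi k (cphi k x))) (Q (cpsi k (cphi k x))) = Q x.
    exact: etrans (congr1 (fun y => tcoord c (f y) (Q y)) xx) (tcoord_self _ _).
  apply: (etrans (diff_mulE v (sM i j) (sgf i j))).
  apply: (cg).
  - apply: (etrans (diff_mulE v (sPi i) (sQj j))).
    apply: (cg).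
    + exact: esym (diff_coord v i sP).
    + exact: (congr1 (fun z : 'rV[R]_n => z 0 j) qx).
    + exact: (congr1 (fun z : 'rV[R]_n => z 0 i) px).
    + exact: esym (diff_coord v j sQ).
  - exact: (congr1 (fun y => g (f y) (E i (f y)) (E j (f y))) xx).
  - exact: (congr2 (fun a b : 'rV[R]_n => a 0 i * b 0 j) px qx).
  - apply: (etrans (der_comp sf v (sg i j))).
    exact: (lc_metric lc (@cdom_open _ _ _ c) (smooth_vf_coord i ac) (smooth_vf_coord j ac) cx).
apply: (etrans e1); apply/esym.
apply: (etrans (riem_leibniz_frame rg (f x) (P x) (Q x) dp dq (fun i => nb (f x) w (E i)))).
by apply: eq_bigr => i _; apply: eq_bigr => j _; rewrite -!Ei.
Qed.

End Pullback.

(** * The Gauss formula *)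

Section Gauss.
Variables (R : realType) (m n : nat) (M : manifold R m) (N : manifold R n).
Variables (f : M -> N) (g : tensor2 N) (nbN : connection_op N) (nbM : connection_op M).
Hypotheses (sf : smooth_map f) (rg : riemannian g) (lcN : levi_civita g nbN).
Hypothesis (lcM : levi_civita (induced_metric f g) nbM).
Implicit Types (x y : M) (W : set M) (X Y Z : M -> 'rV[R]_m).

Local Notation B := (sff f nbN nbM).

Lemma sff_sym W X Y x : open W -> smooth_vf W X -> smooth_vf W Y -> W x ->
  B X Y x = B Y X x.
Proof.
move=> oW sX sY Wx.
have H (a b p q : 'rV[R]_n) : a - b = p - q -> a - p = b - q.
  by move=> /eqP; rewrite subr_eq => /eqP ->; rewrite addrC !addrA addNr add0r addrC.
apply: H; rewrite (nabla_along_torsion sf lcN oW sX sY Wx).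
by rewrite -(lc_torsion_free lcM oW sX sY Wx) linearB.
Qed.

(** The induced connection and [nbM] both compute the derivative of g(df Y, df Z); the two Leibniz
    formulas are subtracted. *)
Lemma sff_skew W X Y Z x : open W -> smooth_vf W X -> smooth_vf W Y -> smooth_vf W Z -> W x ->
  g (f x) (B X Y x) (dmap f x (Z x)) + g (f x) (B X Z x) (dmap f x (Y x)) = 0.
Proof.
move=> oW sX sY sZ Wx.
have ak := chart_at_atlas x; have ac := chart_at_atlas (f x).
have kx := chart_at_dom x; have cx := chart_at_dom (f x).
have sPY := along_smooth_push sf ak ac kx cx (smooth_vf_in oW sY Wx ak kx).
have sPZ := along_smooth_push sf ak ac kx cx (smooth_vf_in oW sZ Wx ak kx).
have e1 := nabla_along_metric sf rg lcN (X x) sPY sPZ.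
have e2 := lc_metric lcM oW sY sZ Wx (X x).
have e := etrans (esym e1) e2; rewrite /push /induced_metric in e.
rewrite /sff !(riemBl rg) [g (f x) (nabla_along f nbN x (X x) (push f Z)) _](riem_sym rg).
rewrite [g (f x) (dmap f x (nbM x (X x) Z)) _](riem_sym rg).
by rewrite addrACA -opprD; apply/eqP; rewrite subr_eq0; apply/eqP.
Qed.

(* The trilinear form g(B(X,Y), df Z) is symmetric in (X,Y) and skew in (Y,Z),
   hence zero: this is the uniqueness of the Levi-Civita connection of M. *)
Lemma sff_normal W X Y x z : open W -> smooth_vf W X -> smooth_vf W Y -> W x ->
  g (f x) (B X Y x) (dmap f x z) = 0.
Proof.
move=> oW sX sY Wx; set k := chart_at x.
have ak : atlas M k := chart_at_atlas x; have kx : cdom k x := chart_at_dom x.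
(* Skewness concerns fields, so the vector [z] is extended with constant components. *)
pose Z := cfield k z; have oWk := openI oW (@cdom_open _ _ _ k).
have sX' : smooth_vf (W `&` cdom k) X by apply: smooth_vf_sub sX; exact: subIsetl.
have sY' : smooth_vf (W `&` cdom k) Y by apply: smooth_vf_sub sY; exact: subIsetl.
have sZ' : smooth_vf (W `&` cdom k) Z.
  by apply: smooth_vf_sub (smooth_vf_cfield z ak); exact: subIsetr.
have Zx : Z x = z by exact: etrans (esym (tcoord_self _ _)) (cfieldK z ak kx).
have Wkx : (W `&` cdom k) x by [].
rewrite -Zx.
have skew X1 X2 X3 s1 s2 s3 : _ = _ := @sff_skew _ X1 X2 X3 x oWk s1 s2 s3 Wkx.
have sym X1 X2 s1 s2 : _ = _ := @sff_sym _ X1 X2 x oWk s1 s2 Wkx.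
(* Up to symmetry the three cyclic instances read a + b = 0, b + c = 0 and c + a = 0, whence 2 a =
   0. *)
have h1 := skew _ _ _ sX' sY' sZ'.
have h2 := skew _ _ _ sZ' sX' sY'.
have h3 := skew _ _ _ sY' sZ' sX'.
rewrite (sym _ _ sX' sZ') in h1; rewrite (sym _ _ sZ' sY') in h2.
rewrite (sym _ _ sY' sX') in h3.
move: h1 h2 h3; set a := g _ _ _; set b := g _ _ _; set c := g _ _ _ => h1 h2 h3.
have : a *+ 2 = (a + b) - (b + c) + (c + a).
  by rewrite mulr2n opprD !addrA addrK addrNK.
by rewrite h1 h2 h3 subrr addr0 => /eqP; rewrite mulrn_eq0 /= => /eqP.
Qed.

End Gauss.

(** * Orthogonal complements and Gram matrices *)

Section LinearAlgebra.
Variables (R : realType) (n : nat) (N : manifold R n) (g : tensor2 N).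
Hypothesis rg : riemannian g.
Implicit Types (x : N) (v w u : 'rV[R]_n) (W : {vspace 'rV[R]_n}).

Lemma mem_bigcapv (I : eqType) (r : seq I) (A : I -> {vspace 'rV[R]_n}) v :
  (v \in (\bigcap_(i <- r) A i)%VS) <-> (forall i, i \in r -> v \in A i).
Proof.
elim: r => [|i r IH]; first by rewrite big_nil memvf.
rewrite big_cons memv_cap; split.
  move=> /andP[vi /IH vr] j; rewrite inE => /orP[/eqP ->//|]; exact: vr.
move=> H; rewrite H ?mem_head//; apply/IH => j jr; apply: H.
by rewrite inE jr orbT.
Qed.

Lemma mem_orth_compl x W v :
  (v \in orth_compl g x W) <-> (forall w, w \in W -> g x v w = 0).
Proof.
have lg w : linear (fun v => g x v w : R^o).
  by move=> a u u'; rewrite (riemDl rg) (riemZl rg).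
have E w : (v \in lker (linfun (fun v => g x v w : R^o))) = (g x v w == 0).
  pose L : {linear 'rV[R]_n -> R^o} := HB.pack (fun v => g x v w : R^o)
    (GRing.isLinear.Build R 'rV[R]_n R^o *:%R _ (lg w)).
  by rewrite memv_ker -[linfun _]/(linfun L) lfunE.
rewrite /orth_compl; split=> [/mem_bigcapv H w wW|H].
  rewrite (coord_vbasis wW) (riem_sumr rg) big1// => i _.
  have : v \in lker (linfun (fun v => g x v (vbasis W)`_i : R^o)).
    by apply: H; rewrite mem_nth// size_tuple.
  by rewrite E => /eqP e; rewrite (riemZr rg) e mulr0.
apply/mem_bigcapv => w wb; rewrite E; apply/eqP/H.
exact: vbasis_mem.
Qed.

Definition gram x s (b : 'I_s -> 'rV[R]_n) : 'M[R]_s := \matrix_(i, j) g x (b i) (b j).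

Lemma mulmx_gram x s (b : 'I_s -> 'rV[R]_n) (t : 'rV[R]_s) j :
  (t *m gram x b) 0 j = g x (\sum_i t 0 i *: b i) (b j).
Proof.
rewrite mxE (riem_suml rg); apply: eq_bigr => i _.
by rewrite mxE (riemZl rg).
Qed.

(** A combination whose coefficients lie in the kernel of the Gram matrix is orthogonal to itself,
    hence zero. *)
Lemma gram_row_free x s (b : 'I_s -> 'rV[R]_n) :
  (forall t : 'rV[R]_s, \sum_i t 0 i *: b i = 0 -> t = 0) -> row_free (gram x b).
Proof.
move=> fb; rewrite -kermx_eq0; apply/rowV0P => t /sub_kermxP tG; apply: fb.
apply: (@riem_eq0 _ _ _ _ rg x).
rewrite {2}(_ : \sum_i _ = \sum_j t 0 j *: b j)// (riem_sumr rg) big1// => j _.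
by rewrite (riemZr rg) -mulmx_gram tG mxE mulr0.
Qed.

Lemma basis_tuple_free s (b : 'I_s -> 'rV[R]_n) W :
  basis_of W [seq b i | i <- enum 'I_s] ->
  forall t : 'rV[R]_s, \sum_i t 0 i *: b i = 0 -> t = 0.
Proof.
move=> /basis_free fb t e; apply/rowP => i; rewrite [RHS]mxE.
have /freeP : free [tuple b i | i < s] by [].
move=> /(_ (fun i => t 0 i)) H; apply: H; rewrite -[RHS]e.
by apply: eq_bigr => j _; rewrite -tnth_nth tnth_mktuple.
Qed.

Lemma basis_tuple_coord (vT : vectType R) s (b : 'I_s -> vT) (W : {vspace vT}) (v : vT) :
  basis_of W [seq b i | i <- enum 'I_s] -> v \in W ->
  exists t : 'rV[R]_s, v = \sum_i t 0 i *: b i.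
Proof.
move=> bW vW; have bW' : basis_of W [tuple b i | i < s] by [].
exists (\row_i coord [tuple b i | i < s] i v).
rewrite {1}(coord_basis bW' vW); apply: eq_bigr => j _.
by rewrite mxE -tnth_nth tnth_mktuple.
Qed.

Lemma orth_projection x W v : exists2 w, w \in W & forall u, u \in W -> g x (v - w) u = 0.
Proof.
pose b (i : 'I_(\dim W)) := (vbasis W)`_i.
have fb (t : 'rV[R]_(\dim W)) : \sum_i t 0 i *: b i = 0 -> t = 0.
  move=> e; apply/rowP => i; rewrite [RHS]mxE.
  have /freeP := basis_free (vbasisP W).
  by move=> /(_ (fun i => t 0 i)) H; exact: H.
have uG : gram x b \in unitmx by rewrite -row_free_unit; exact: gram_row_free.
(* The solution of the normal equations for the projection of [v]. *)
pose t := (\row_j g x v (b j)) *m invmx (gram x b).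
have bW i : b i \in W by apply: vbasis_mem; rewrite mem_nth// size_tuple.
exists (\sum_i t 0 i *: b i).
  by apply: memv_suml => i _; apply: memvZ.
move=> u uW; rewrite (coord_vbasis uW) (riem_sumr rg) big1// => j _.
rewrite (riemZr rg) (riemBl rg) -mulmx_gram /t -mulmxA mulVmx// mulmx1 mxE subrr.
by rewrite mulr0.
Qed.

End LinearAlgebra.

(** * Bundle-like metrics *)

Section CR.
Variables (R : realType) (m n : nat) (N : manifold R n) (gN : tensor2 N).
Variables (nbN : connection_op N) (sigma : N -> {vspace 'End('rV[R]_n)}).
Variables (M : manifold R m) (f : M -> N) (nbM : connection_op M).
Variables (D Dp : M -> {vspace 'rV[R]_m}).
Hypotheses (hN : quaternion_kahler gN nbN sigma) (hf : immersion f).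
Hypotheses (hM : levi_civita (induced_metric f gN) nbM).
Hypothesis (hCR : quaternion_CR f gN sigma D Dp).
Implicit Types (x y : M) (W : set M) (X Y Z U V : M -> 'rV[R]_m).

Local Notation gM := (induced_metric f gN).

Let sf : smooth_map f := hf.1.
Let rg : riemannian gN := qk_riemannian hN.
Let lcN : levi_civita gN nbN := qk_levi_civita hN.

Lemma dmap_inj x : injective (dmap f x).
Proof. by apply/lker0P/eqP; exact: hf.2. Qed.

Lemma induced_metricDl x u v w : gM x (u + v) w = gM x u w + gM x v w.
Proof. by rewrite /induced_metric linearD (riemDl rg). Qed.

Lemma induced_metric_sym x u v : gM x u v = gM x v u.
Proof. exact: riem_sym rg _ _ _. Qed.

Lemma induced_metric_eq0 x u : gM x u u = 0 -> u = 0.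
Proof. by move=> /(riem_eq0 rg) e; apply: (@dmap_inj x); rewrite e linear0. Qed.

Lemma D_Dp_orth x u v : u \in D x -> v \in Dp x -> gM x u v = 0.
Proof. exact: (cr_orthogonal hCR). Qed.

Lemma cap_D_Dp x : (D x :&: Dp x)%VS = 0%VS.
Proof.
apply/eqP; rewrite -subv0; apply/subvP => u; rewrite memv_cap => /andP[u1 u2].
by rewrite memv0; apply/eqP; apply: (@induced_metric_eq0 x); exact: D_Dp_orth.
Qed.

Lemma cap_Dp_D x : (Dp x :&: D x)%VS = 0%VS.
Proof. by rewrite capvC cap_D_Dp. Qed.

Lemma projD x u : u = daddv_pi (D x) (Dp x) u + daddv_pi (Dp x) (D x) u.
Proof.
by rewrite daddv_pi_add ?cap_D_Dp// (cr_complementary hCR) memvf.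
Qed.

Lemma projD_metric x u v : v \in D x -> gM x (daddv_pi (D x) (Dp x) u) v = gM x u v.
Proof.
move=> vD; rewrite [in RHS](projD x u) induced_metricDl [X in _ + X]induced_metric_sym.
by rewrite (D_Dp_orth vD) ?addr0// memv_pi.
Qed.

Lemma projDp_metric x u v : v \in Dp x -> gM x (daddv_pi (Dp x) (D x) u) v = gM x u v.
Proof.
move=> vD; rewrite [in RHS](projD x u) induced_metricDl.
by rewrite (D_Dp_orth (memv_pi (D x) (Dp x) u) vD) add0r.
Qed.

Lemma projDp_id x u : u \in Dp x -> daddv_pi (Dp x) (D x) u = u.
Proof. exact: daddv_pi_id (cap_Dp_D x). Qed.

Lemma smooth_in_induced_metric W X Y x : open W -> smooth_vf W X -> smooth_vf W Y -> W x ->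
  smooth_in (chart_at x) x (fun y => gM y (X y) (Y y) : R^o).
Proof.
move=> oW sX sY Wx.
have ak := chart_at_atlas x; have ac := chart_at_atlas (f x).
have kx := chart_at_dom x; have cx := chart_at_dom (f x).
have sPX := along_smooth_push sf ak ac kx cx (smooth_vf_in oW sX Wx ak kx).
have sPY := along_smooth_push sf ak ac kx cx (smooth_vf_in oW sY Wx ak kx).
exact: (smooth_in_metric sf rg ak ac kx cx sPX sPY).
Qed.

(** The bracket in [intrinsic] involves this field, and torsion freeness applies to it only once it
    is smooth. In a local frame F of [Dp] its coefficients solve the Gram system with right-hand
    side g(X, F_j). *)
Lemma smooth_projDp W X : open W -> smooth_vf W X ->
  smooth_vf W (fun y => daddv_pi (Dp y) (D y) (X y)).
Proof.
move=> oW sX; apply/smooth_vfP => // x Wx.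
have [s H] := cr_Dp hCR; have [ O [ oO Ox [F [sF bF]]]] := H x.
set k := chart_at x; have ak : atlas M k := chart_at_atlas x.
have kx : cdom k x := chart_at_dom x.
have oWO := openI oW oO; have WOx : (W `&` O) x by [].
have sX' : smooth_vf (W `&` O) X by apply: smooth_vf_sub sX; exact: subIsetl.
have sF' i : smooth_vf (W `&` O) (F i) by apply: smooth_vf_sub (sF i); exact: subIsetr.
pose X' y := daddv_pi (Dp y) (D y) (X y).
(* Coefficients are chosen at every point; outside [O] the requirement is vacuous. *)
have bX y : exists t : 'rV[R]_s, O y -> X' y = \sum_i t 0 i *: F i y.
  case: (pselect (O y)) => [Oy|nOy]; last by exists 0.
  have [t e] := basis_tuple_coord (bF y Oy) (memv_pi (Dp y) (D y) (X y)).
  by exists t.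
pose t y := sval (cid (bX y)).
have tE y : O y -> X' y = \sum_i t y 0 i *: F i y by rewrite /t; case: cid.
pose GM y : 'M[R]_s := \matrix_(i, j) gM y (F i y) (F j y).
have st : smooth_at (cphi k x) (t \o cpsi k).
  apply: (@smooth_at_solve _ _ _ _ _ (fun p => GM (cpsi k p))
           (fun p => \row_j gM (cpsi k p) (X (cpsi k p)) (F j (cpsi k p)))).
  - move=> i j; apply: smooth_at_ext (smooth_in_induced_metric oWO (sF' i) (sF' j) WOx) => p.
    by rewrite mxE.
  - apply/smooth_at_coordP => j.
    apply: smooth_at_ext (smooth_in_induced_metric oWO sX' (sF' j) WOx) => p.
    by rewrite mxE.
  - have nO : \forall y \near x, O y by exact: open_nbhs_nbhs.
    apply: filterS (near_cpsi kx nO) => p Op; set y := cpsi k p in Op *.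
    have GE : GM y = gram gN (f y) (fun i => dmap f y (F i y)).
      by apply/matrixP => i j; rewrite !mxE.
    split.
      apply/rowP => j; rewrite GE (mulmx_gram rg) mxE -[RHS]projDp_metric; last first.
        by apply: (basis_mem (bF y Op)); apply: map_f; rewrite mem_enum.
      rewrite -/(X' y) (tE y Op) /induced_metric linear_sum; congr (gN _ _ _).
      by apply: eq_bigr => i _; rewrite linearZ.
    rewrite GE; apply: (gram_row_free rg) => u e.
    apply: (basis_tuple_free (bF y Op)); apply: (@dmap_inj y).
    rewrite linear0 -[RHS]e linear_sum; apply: eq_bigr => i _.
    by rewrite linearZ.
have nO : \forall y \near x, \sum_i t y 0 i *: F i y = X' y.
  by apply: filterS (open_nbhs_nbhs (conj oO Ox)) => y Oy; rewrite (tE _ Oy).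
apply: (vsmooth_in_eq kx nO); apply: vsmooth_in_sum => i.
have sti : smooth_in k x (fun y => t y 0 i : R^o).
  by have /smooth_at_coordP sti := st; exact: sti.
exact: (vsmooth_inZ sti (smooth_vf_in oWO (sF' i) WOx ak kx)).
Qed.

(** [bundle_like] speaks of fields, the condition derived from it of a vector [u]; constant
    coefficients in a local frame of [Dp] link the two. *)
Lemma extend_Dp x u : u \in Dp x -> exists O Z,
  [/\ open O, O x, is_section Dp O Z & Z x = u].
Proof.
move=> uD; have [s H] := cr_Dp hCR; have [ O [ oO Ox [F [sF bF]]]] := H x.
have [t e] := basis_tuple_coord (bF x Ox) uD.
exists O, (fun y => \sum_i t 0 i *: F i y); split => //; split.
  apply: smooth_vf_sum => // i; apply: smooth_vfZ => //.
  apply/(smooth_funP _ (@scalar_comp_closed R) oO) => y Oy.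
  exact: smooth_at_cst.
move=> y Oy; apply: memv_suml => i _; apply: memvZ.
by apply: (basis_mem (bF y Oy)); apply: map_f; rewrite mem_enum.
Qed.

Lemma nabla_D_Dp W V Z x v : open W -> is_section D W V -> is_section Dp W Z -> W x ->
  gM x (nbM x v Z) (V x) = - gM x (Z x) (nbM x v V).
Proof.
move=> oW [sV hV] [sZ hZ] Wx.
have e := lc_metric hM oW sZ sV Wx v.
have nW : \forall p \near cphi (chart_at x) x, (fun _ : 'rV[R]_m => 0 : R^o) p =
    ((fun y => gM y (Z y) (V y) : R^o) \o cpsi (chart_at x)) p.
  apply: filterS (near_cpsi (chart_at_dom x) (open_nbhs_nbhs (conj oW Wx))) => p Wp /=.
  by rewrite induced_metric_sym (D_Dp_orth (hV _ Wp) (hZ _ Wp)).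
have e0 := congr1 (@^~ v) (smooth_at_near_diff (smooth_at_cst _ (0 : R^o)) nW).
have z0 := diff_cstE (cphi (chart_at x) x) (0 : R^o) v.
have e1 : 0 = gM x (nbM x v Z) (V x) + gM x (Z x) (nbM x v V).
  by apply: (etrans (esym z0)); apply: (etrans e0); exact: e.
by apply/eqP; rewrite -addr_eq0 -e1.
Qed.

(** Against [V] in [D] the projections Q disappear. Writing [Q'X, U] as nabla_{Q'X} U - nabla_U
    (Q'X), the directions QX and Q'X recombine into nabla_X U, and the last term becomes g(Q'X,
    nabla_U V) by [nabla_D_Dp]. *)
Lemma intrinsic_metric W X U V x : open W -> smooth_vf W X ->
  is_section D W U -> is_section D W V -> W x ->
  gM x (intrinsic nbM D Dp X U x) (V x) =
  gM x (nbM x (X x) U) (V x) +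
  gM x (daddv_pi (Dp x) (D x) (X x)) (nbM x (U x) V).
Proof.
move=> oW sX [sU hU] [sV hV] Wx.
pose X' y := daddv_pi (Dp y) (D y) (X y).
have sX' : smooth_vf W X' by exact: smooth_projDp.
have secX' : is_section Dp W X' by split=> // y _; exact: memv_pi.
have Vx := hV x Wx.
rewrite /intrinsic induced_metricDl !projD_metric// -/X'.
rewrite -(lc_torsion_free hM oW sX' sU Wx).
rewrite -[nbM x (X' x) U - _]addrC induced_metricDl.
have lin := nabla_linear (lc_connection hM) oW sU Wx 1 (daddv_pi (D x) (Dp x) (X x)) (X' x).
rewrite !scale1r -projD in lin; rewrite lin induced_metricDl.
rewrite addrCA [RHS]addrC; congr (_ + _).
have H := nabla_D_Dp (U x) oW (conj sV hV) secX' Wx.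
have -> : gM x (- nbM x (U x) X') (V x) = - gM x (nbM x (U x) X') (V x).
  by rewrite /induced_metric linearN (riemNl rg).
by rewrite H opprK.
Qed.

(** The [Dp]-component of nabla_U V is skew in U and V. For integrable [D] this says that the leaves
    of [D] are totally geodesic. *)
Definition totally_geodesic := forall x W U V u, open W -> is_section D W U ->
  is_section D W V -> W x -> u \in Dp x ->
  gM x u (nbM x (U x) V) + gM x u (nbM x (V x) U) = 0.

Lemma is_section_sub (E : M -> {vspace 'rV[R]_m}) O O' X : O' `<=` O ->
  is_section E O X -> is_section E O' X.
Proof.
by move=> OO' [sX hX]; split; [exact: smooth_vf_sub sX|move=> x /OO'; exact: hX].
Qed.

(** Metricity cancels the terms in nabla_X U and nabla_X V, so parallelism only constrains the
    [Dp]-component of X. Choosing X to be a section of [Dp] through [u] reaches every vector [u]. *)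
Lemma bundle_like_totally_geodesic : bundle_like gM nbM D Dp <-> totally_geodesic.
Proof.
have key W X U V x : open W -> smooth_vf W X ->
    is_section D W U -> is_section D W V -> W x ->
    (der (fun y => gM y (U y) (V y) : R^o) x (X x) =
        gM x (intrinsic nbM D Dp X U x) (V x) +
        gM x (U x) (intrinsic nbM D Dp X V x)) <->
    gM x (daddv_pi (Dp x) (D x) (X x)) (nbM x (U x) V) +
    gM x (daddv_pi (Dp x) (D x) (X x)) (nbM x (V x) U) = 0.
  move=> oW sX hU hV Wx.
  rewrite (lc_metric hM oW hU.1 hV.1 Wx) [gM x (U x) (intrinsic _ _ _ _ _ _)]induced_metric_sym.
  rewrite (intrinsic_metric oW sX hU hV Wx) (intrinsic_metric oW sX hV hU Wx).
  rewrite [gM x (U x) _]induced_metric_sym addrACA.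
  split=> [/esym/eqP|->]; last by rewrite addr0.
  by rewrite -[X in _ == X]addr0 => /eqP/addrI.
split=> [bl x W U V u oW hU hV Wx uD|kc O X U V oO sX hU hV x Ox]; last first.
  by apply/(key O X U V x oO sX hU hV Ox); exact: (kc x O U V _ oO hU hV Ox (memv_pi _ _ _)).
have [ O [Z [ oO Ox hZ Zx]]] := extend_Dp uD.
have oWO := openI oW oO.
have hU' : is_section D (W `&` O) U by apply: is_section_sub hU; exact: subIsetl.
have hV' : is_section D (W `&` O) V by apply: is_section_sub hV; exact: subIsetl.
have hZ' : is_section Dp (W `&` O) Z by apply: is_section_sub hZ; exact: subIsetr.
have WOx : (W `&` O) x by [].
have := bl _ Z U V oWO hZ'.1 hU' hV' x WOx.
by move/(key _ _ _ _ _ oWO hZ'.1 hU' hV' WOx); rewrite projDp_id Zx.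
Qed.

End CR.

(** * Quaternion CR-submanifolds *)

Section Quaternions.
Variables (R : realType) (n : nat) (N : manifold R n) (gN : tensor2 N).
Variables (sigma : N -> {vspace 'End('rV[R]_n)}) (O : set N).
Variables (J : 'I_3 -> N -> 'End('rV[R]_n)).
Hypothesis hJ : canonical_basis gN sigma O J.
Variables (z : N) (Oz : O z).

Lemma J_square a v : J a z (J a z v) = - v.
Proof.
have /(congr1 (fun h : 'End('rV[R]_n) => h v)) := canonical_square hJ Oz a.
by rewrite comp_lfunE opp_lfunE id_lfunE.
Qed.

(** Neither the index nor the sign is recorded: every J_c maps [Dp] to normal vectors, which is all
    that [J_Dp_orth] asks. *)
Lemma J_product a b v : a != b ->
  exists c, J a z (J b z v) = J c z v \/ J a z (J b z v) = - J c z v.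
Proof.
have J01 u : J 0 z (J 1 z u) = J 2 z u.
  have /(congr1 (fun h : 'End('rV[R]_n) => h u)) := canonical_mul hJ Oz.
  by rewrite comp_lfunE.
have J10 u : J 1 z (J 0 z u) = - J 2 z u.
  have /(congr1 (fun h : 'End('rV[R]_n) => h u)) := canonical_anti hJ Oz.
  by rewrite comp_lfunE opp_lfunE.
have ord3 (i : 'I_3) : [\/ i = 0, i = 1 | i = 2].
  case: i => [[|[|[|//]]] Hi]; [apply: Or31|apply: Or32|apply: Or33];
  exact: val_inj.
have [-> | -> | ->] := ord3 a; have [-> | -> | ->] := ord3 b => // _.
- by exists 2; left.
- by exists 1; right; rewrite -J01 J_square.
- by exists 2; right.
- by exists 0; left; rewrite -[J 2 z v]opprK -J10 linearN /= J_square opprK.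
- by exists 1; left; rewrite -[J 2 z _]opprK -J10 J_square linearN /= opprK.
- by exists 0; right; rewrite -J01 J_square linearN.
Qed.

End Quaternions.

(** * The subspaces J_a Dp of the normal space and the fields J_a V *)

Section CRNormal.
Variables (R : realType) (m n : nat) (N : manifold R n) (gN : tensor2 N).
Variables (nbN : connection_op N) (sigma : N -> {vspace 'End('rV[R]_n)}).
Variables (M : manifold R m) (f : M -> N) (nbM : connection_op M).
Variables (D Dp : M -> {vspace 'rV[R]_m}).
Hypotheses (hN : quaternion_kahler gN nbN sigma) (hf : immersion f).
Hypotheses (hM : levi_civita (induced_metric f gN) nbM).
Hypothesis (hCR : quaternion_CR f gN sigma D Dp).
Variables (O : set N) (J : 'I_3 -> N -> 'End('rV[R]_n)).
Hypotheses (oO : open O) (hJ : canonical_basis gN sigma O J).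
Implicit Types (x y : M) (W : set M) (X Y Z U V : M -> 'rV[R]_m).

Let sf : smooth_map f := hf.1.
Let rg : riemannian gN := qk_riemannian hN.
Let lcN : levi_civita gN nbN := qk_levi_civita hN.

Lemma mem_normal_at x w :
  (w \in normal_at f gN x) <-> (forall v, gN (f x) w (dmap f x v) = 0).
Proof.
split=> [/(mem_orth_compl rg) H v|H]; first by apply: H; exact: memv_img (memvf v).
by apply/(mem_orth_compl rg) => _ /memv_imgP[v _ ->].
Qed.

Lemma J_Dp_normal x a u v : O (f x) -> u \in Dp x ->
  gN (f x) (J a (f x) (dmap f x u)) (dmap f x v) = 0.
Proof.
move=> Ofx uD; have /subvP H := cr_Dp_real hCR oO hJ Ofx a.
by have /mem_normal_at := H _ (memv_img _ (memv_img _ uD)); apply.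
Qed.

Lemma J_D_tangent x a u : O (f x) -> u \in D x ->
  exists2 v, v \in D x & J a (f x) (dmap f x u) = dmap f x v.
Proof.
move=> Ofx uD; have /subvP H := cr_D_invariant hCR oO hJ Ofx a.
by have /memv_imgP[v vD e] := H _ (memv_img _ (memv_img _ uD)); exists v.
Qed.

(** Applying the isometry [J b] turns the product into -g(J_b J_a u, v); here J_b J_a u is plus or
    minus some J_c u, a normal vector, while v is tangent. *)
Lemma J_Dp_orth x a b u v : O (f x) -> u \in Dp x -> v \in Dp x -> a != b ->
  gN (f x) (J a (f x) (dmap f x u)) (J b (f x) (dmap f x v)) = 0.
Proof.
move=> Ofx uD vD ab; rewrite -(canonical_isometry hJ Ofx b) (J_square hJ Ofx).
rewrite (riemNr rg); apply/eqP; rewrite oppr_eq0; apply/eqP.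
rewrite eq_sym in ab.
have [c [-> | ->]] := J_product hJ Ofx (dmap f x u) ab.
  exact: J_Dp_normal.
by rewrite (riemNl rg) J_Dp_normal ?oppr0.
Qed.

Lemma sum_perm3 (V : nmodType) (s : 'S_3) (F : 'I_3 -> V) :
  \sum_(i < 3) F i = F (s 0) + F (s 1) + F (s 2).
Proof.
rewrite (reindex_inj (@perm_inj _ s)) !big_ord_recl big_ord0 /= addr0 addrA.
by congr (F (s _) + F (s _) + F (s _)); exact: val_inj.
Qed.

(** For the converse implication [w] is split by its projection p onto [mu_perp]; the point is that
    p has no component in the summand of index [s 0]. *)
Lemma mem_mu_sum x (s : 'S_3) w : O (f x) -> w \in normal_at f gN x ->
  (w \in (mu f gN J Dp x + Jpushv f (J (s 1%R)) x (Dp x)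
            + Jpushv f (J (s 2%R)) x (Dp x))%VS) <->
  (forall u, u \in Dp x -> gN (f x) w (J (s 0) (f x) (dmap f x u)) = 0).
Proof.
move=> Ofx wn.
have s01 : s 1 != s 0 by rewrite (inj_eq perm_inj).
have s02 : s 2 != s 0 by rewrite (inj_eq perm_inj).
split.
  move=> /memv_addP[w1 /memv_addP[w0 w0m [_ /memv_imgP[_ /memv_imgP[u1 u1D ->] ->] ->]]].
  move=> [_ /memv_imgP[_ /memv_imgP[u2 u2D ->] ->] ->] u uD.
  rewrite !(riemDl rg) !J_Dp_orth// !addr0.
  move: w0m; rewrite memv_cap => /andP[_ /(mem_orth_compl rg)]; apply.
  by apply: (subvP (sumv_sup (s 0) _ (subvv _))) => //; do 2!apply: memv_img.
move=> H.
have [p pm hp] := orth_projection rg (f x) (mu_perp f J Dp x) w.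
have /memv_sumP[q qm pE] := pm.
have qE i : exists2 u, u \in Dp x & q i = J i (f x) (dmap f x u).
  by have /memv_imgP[_ /memv_imgP[u uD ->] ->] := qm i isT; exists u.
have pn : p \in normal_at f gN x.
  rewrite pE; apply: memv_suml => i _; have [u uD ->] := qE i.
  by apply/mem_normal_at => v; exact: J_Dp_normal.
have mum : w - p \in mu f gN J Dp x.
  rewrite memv_cap memvB//=; apply/(mem_orth_compl rg) => v vm; exact: hp.
have [u0 u0D q0] := qE (s 0).
(* This component is orthogonal to [w] by [H], to [w - p] by projection and to the other two
   components by [J_Dp_orth], hence to itself. *)
have q00 : q (s 0) = 0.
  apply: (riem_eq0 rg (x := f x)).
  have Jm : J (s 0) (f x) (dmap f x u0) \in mu_perp f J Dp x.
    by apply: (subvP (sumv_sup (s 0) _ (subvv _))) => //; do 2!apply: memv_img.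
  have := hp _ Jm; rewrite (riemBl rg) (H _ u0D) sub0r => /eqP; rewrite oppr_eq0 => /eqP.
  rewrite pE (sum_perm3 s) !(riemDl rg) -q0.
  have [u1 u1D q1] := qE (s 1); have [u2 u2D q2] := qE (s 2).
  have z1 : gN (f x) (q (s 1)) (q (s 0)) = 0 by rewrite q0 q1; exact: J_Dp_orth.
  have z2 : gN (f x) (q (s 2)) (q (s 0)) = 0 by rewrite q0 q2; exact: J_Dp_orth.
  by rewrite z1 z2 !addr0.
have -> : w = (w - p) + q (s 1) + q (s 2).
  have pE3 : p = q (s 1) + q (s 2) by rewrite pE (sum_perm3 s) q00 add0r.
  by rewrite -addrA -pE3 subrK.
by apply: memv_add; [apply: memv_add|]; rewrite ?qm.
Qed.

Lemma tangent_JE x a V : O (f x) -> V x \in D x ->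
  dmap f x (tangent_J f (J a) V x) = J a (f x) (push f V x) /\
  tangent_J f (J a) V x \in D x.
Proof.
move=> Ofx VD; have [v vD e] := J_D_tangent a Ofx VD.
have E : tangent_J f (J a) V x = v.
  apply: (dmap_inj hf (x := x)); rewrite /tangent_J /push e.
  by rewrite limg_lfunVK// memv_img// memvf.
by rewrite E /push e.
Qed.

(** Read in charts, df is a smooth matrix with independent rows, and the components of J_a V solve a
    linear system in it. Smoothness makes the Gauss formula applicable to B(U, J_a V). *)
Lemma smooth_tangent_J W a V : open W -> W `<=` f @^-1` O -> is_section D W V ->
  smooth_vf W (tangent_J f (J a) V).
Proof.
move=> oW WO [sV hV]; apply/smooth_vfP => // x Wx.
set c := chart_at (f x); set k := chart_at x.
have ak : atlas M k := chart_at_atlas x; have ac : atlas N c := chart_at_atlas (f x).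
have kx : cdom k x := chart_at_dom x; have cx : cdom c (f x) := chart_at_dom (f x).
have sPV := along_smooth_push sf ak ac kx cx (smooth_vf_in oW sV Wx ak kx).
have sJPV := along_smooth_End sf oO (canonical_smooth hJ a) ak ac kx cx (WO _ Wx) sPV.
have sF := smooth_in_map sf ak ac kx cx.
pose F := cphi c \o f \o cpsi k.
pose A p : 'M[R]_(m, n) := \matrix_(i, j) ('d F p (delta_mx 0 i)) 0 j.
have mulA p t : t *m A p = 'd F p t.
  rewrite diff_sum_coord; apply/rowP => j; rewrite mxE summxE.
  by apply: eq_bigr => i _; rewrite !mxE.
apply: (@smooth_at_solve _ _ _ _ _ A _ _ _ sJPV).
  move=> i j; have /smooth_at_coordP sFi := smooth_at_diff (delta_mx 0 i) sF.
  by apply: smooth_at_ext (sFi j) => p; rewrite mxE.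
have nW : \forall y \near x, W y by exact: open_nbhs_nbhs.
apply: filterS (filterI (near_cpsiK kx) (near_cpsi kx (filterI nW (near_smooth_map sf (cdom_near cx))))).
move=> p [[kp pK] [Wp cp]]; set y := cpsi k p in kp pK Wp cp *.
have dE v : 'd F p (tcoord k y v) = tcoord c (f y) (dmap f y v).
  by rewrite (tcoord_dmap sf v ak ac kp cp) pK.
split.
  rewrite mulA /= -/y dE; congr (tcoord _ _ _).
  by have [] := tangent_JE a (WO _ Wp) (hV _ Wp).
rewrite -kermx_eq0; apply/rowV0P => u /sub_kermxP; rewrite mulA => u0.
have := dE (cfield k u y); rewrite (cfieldK u ak kp) u0 => /esym e.
have e1 : dmap f y (cfield k u y) = 0.
  by apply: (tcoord_inj ac cp); rewrite e linear0.
have e2 : cfield k u y = 0 by apply: (dmap_inj hf (x := y)); rewrite e1 linear0.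
by rewrite -(cfieldK u ak kp) e2 linear0.
Qed.

(** Needed because df ([tangent_J] V) and J_a df V agree only where the basis is defined and V lies
    in [D]. *)
Lemma nabla_along_eq x v P Q :
  along_smooth f (chart_at x) (chart_at (f x)) x P ->
  (\forall y \near x, P y = Q y) ->
  nabla_along f nbN x v P = nabla_along f nbN x v Q.
Proof.
move=> sP e; have kx := chart_at_dom x.
have sQ := along_smooth_eq kx e sP.
rewrite (nabla_alongE _ _ sP) (nabla_alongE _ _ sQ) (nbhs_singleton e).
apply: (congr1 (+%R^~ _)).
have e' : \forall p \near cphi (chart_at x) x,
    ((fun y => tcoord (chart_at (f x)) (f y) (P y)) \o cpsi (chart_at x)) p =
    ((fun y => tcoord (chart_at (f x)) (f y) (Q y)) \o cpsi (chart_at x)) p.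
  by apply: filterS (near_cpsi kx e) => p /= ->.
exact: (congr1 (@^~ v) (smooth_at_near_diff sP e')).
Qed.

(* sigma is parallel and sigma V is tangent to M, so differentiating J_a V only
   produces, up to terms orthogonal to J_a Dp, the vector J_a nabla V. *)
Lemma sff_tangent_J W a U V x u : open W -> W `<=` f @^-1` O ->
  is_section D W U -> is_section D W V -> W x -> u \in Dp x ->
  gN (f x) (sff f nbN nbM U (tangent_J f (J a) V) x) (J a (f x) (dmap f x u)) =
  induced_metric f gN x u (nbM x (U x) V).
Proof.
move=> oW WO [sU hU] hVs Wx uD; have [sV hV] := hVs.
set c := chart_at (f x); set k := chart_at x.
have ak : atlas M k := chart_at_atlas x; have ac : atlas N c := chart_at_atlas (f x).
have kx : cdom k x := chart_at_dom x; have cx : cdom c (f x) := chart_at_dom (f x).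
have Ofx : O (f x) := WO _ Wx.
have sPV := along_smooth_push sf ak ac kx cx (smooth_vf_in oW sV Wx ak kx).
have sJPV := along_smooth_End sf oO (canonical_smooth hJ a) ak ac kx cx Ofx sPV.
have Jin z : O z -> J a z \in sigma z.
  by move=> Oz; apply: (basis_mem (canonical_basis_of hJ Oz)); apply: map_f; rewrite mem_enum.
have [T Tsig HT] := qk_parallel hN oO (canonical_smooth hJ a) Jin Ofx (dmap f x (U x)).
have oOc := openI oO (@cdom_open _ _ _ c).
have e1 : nabla_along f nbN x (U x) (fun y => J a (f y) (push f V y)) =
    J a (f x) (nabla_along f nbN x (U x) (push f V)) + T (push f V x).
  apply: (nabla_along_End sf (lc_connection lcN) (S := J a) (T := fun _ => T) oO
    (canonical_smooth hJ a) Ofx sPV) => i.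
  apply: (HT (O `&` cdom c)) => //.
  by apply: smooth_vf_sub (smooth_vf_coord i ac); exact: subIsetr.
have e2 : nabla_along f nbN x (U x) (push f (tangent_J f (J a) V)) =
    nabla_along f nbN x (U x) (fun y => J a (f y) (push f V y)).
  apply/esym; apply: (nabla_along_eq _ sJPV).
  apply: filterS (open_nbhs_nbhs (conj oW Wx)) => y Wy.
  by have [] := tangent_JE a (WO _ Wy) (hV _ Wy).
have Jn v : gN (f x) (dmap f x v) (J a (f x) (dmap f x u)) = 0.
  by rewrite (riem_sym rg); exact: J_Dp_normal.
rewrite /sff (riemBl rg) Jn subr0 e2 e1 (riemDl rg) (canonical_isometry hJ Ofx).
(* [T] is a combination of the J_i, each of which keeps [D] tangent, so T (df V) is tangent while
   J_a df u is normal. *)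
have -> : gN (f x) (T (push f V x)) (J a (f x) (dmap f x u)) = 0.
  have [t ->] := basis_tuple_coord (canonical_basis_of hJ Ofx) Tsig.
  rewrite sum_lfunE (riem_suml rg) big1// => i _.
  rewrite scale_lfunE (riemZl rg).
  by have [v _ ->] := J_D_tangent i Ofx (hV _ Wx); rewrite Jn mulr0.
rewrite addr0 /induced_metric.
(* The isometry has removed J_a; against the tangent vector df u, the derivative of df V may be
   replaced by df (nabla_U V). *)
have := sff_normal sf rg lcN hM u oW sU sV Wx.
rewrite /sff (riemBl rg) => /eqP; rewrite subr_eq0 => /eqP ->.
exact: riem_sym rg _ _ _.
Qed.

End CRNormal.

Theorem theorem5p1 (R : realType) (m n : nat)
    (N : manifold R n) (gN : tensor2 N) (nbN : connection_op N)
    (sigma : N -> {vspace 'End('rV[R]_n)})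
    (M : manifold R m) (f : M -> N) (nbM : connection_op M)
    (D Dp : M -> {vspace 'rV[R]_m})
    (hN : quaternion_kahler gN nbN sigma)
    (hf : immersion f)
    (hM : levi_civita (induced_metric f gN) nbM)
    (hCR : quaternion_CR f gN sigma D Dp) :
  bundle_like (induced_metric f gN) nbM D Dp <->
  (forall (O : set N) (J : 'I_3 -> N -> 'End('rV[R]_n)),
     open O -> canonical_basis gN sigma O J ->
   forall (W : set M) (U V : M -> 'rV[R]_m),
     open W -> W `<=` f @^-1` O -> is_section D W U -> is_section D W V ->
   forall s : 'S_3, ~~ odd_perm s ->
   let a := s 0 in let b := s 1 in let c := s 2 in
   forall x : M, W x ->
     sff f nbN nbM U (tangent_J f (J a) V) x +
     sff f nbN nbM V (tangent_J f (J a) U) x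
       \in (mu f gN J Dp x + Jpushv f (J b) x (Dp x)
            + Jpushv f (J c) x (Dp x))%VS).
Proof.
have sf : smooth_map f := hf.1.
have rg : riemannian gN := qk_riemannian hN.
have lcN : levi_civita gN nbN := qk_levi_civita hN.
(* The resulting condition does not involve [J] or [s]: for fixed fields and a fixed point, all
   instances of (ii) are equivalent to it. *)
have key O J W U V (s : 'S_3) x : open O -> canonical_basis gN sigma O J ->
    open W -> W `<=` f @^-1` O -> is_section D W U -> is_section D W V -> W x ->
    (sff f nbN nbM U (tangent_J f (J (s 0)) V) x +
     sff f nbN nbM V (tangent_J f (J (s 0)) U) x
       \in (mu f gN J Dp x + Jpushv f (J (s 1)) x (Dp x)
            + Jpushv f (J (s 2)) x (Dp x))%VS) <->
    (forall u, u \in Dp x -> induced_metric f gN x u (nbM x (U x) V) +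
       induced_metric f gN x u (nbM x (V x) U) = 0).
  move=> oO hJ oW WO hU hV Wx.
  have nrm X Y : is_section D W X -> is_section D W Y ->
      sff f nbN nbM X (tangent_J f (J (s 0)) Y) x \in normal_at f gN x.
    move=> hX hY; apply/(mem_normal_at f hN) => v.
    apply: (sff_normal sf rg lcN hM v oW hX.1 _ Wx).
    exact: (smooth_tangent_J hf hCR oO hJ (s 0) oW WO hY).
  have H := mem_mu_sum hN hCR oO hJ s (WO _ Wx) (memvD (nrm U V hU hV) (nrm V U hV hU)).
  have E u : u \in Dp x ->
     gN (f x) (sff f nbN nbM U (tangent_J f (J (s 0)) V) x +
       sff f nbN nbM V (tangent_J f (J (s 0)) U) x) (J (s 0) (f x) (dmap f x u)) =
     induced_metric f gN x u (nbM x (U x) V) + induced_metric f gN x u (nbM x (V x) U).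
    move=> uD; rewrite (riemDl rg); congr (_ + _).
      exact: (sff_tangent_J hN hf hM hCR oO hJ (s 0) oW WO hU hV Wx uD).
    exact: (sff_tangent_J hN hf hM hCR oO hJ (s 0) oW WO hV hU Wx uD).
  apply: (iff_trans H); split=> K u uD; first by rewrite -E// K.
  by rewrite E// K.
split=> [/(bundle_like_totally_geodesic hN hf hM hCR) kc|H].
  move=> O J oO hJ W U V oW WO hU hV s _ a b c x Wx.
  by apply/(key O J W U V s x oO hJ oW WO hU hV Wx) => u uD; exact: (kc x W U V u oW hU hV Wx uD).
apply/(bundle_like_totally_geodesic hN hf hM hCR) => x W U V u oW hU hV Wx uD.
(* Any basis around [f x] will do; [W] is then shrunk to the part that [f] sends into its domain. *)
have [ O [J [ oO Ofx hJ]]] := qk_basis hN (f x).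
have oW' : open (W `&` f @^-1` O).
  by apply: openI => //; apply: open_comp => // y _; exact: (smooth_map_continuous sf).
have hU' : is_section D (W `&` f @^-1` O) U by apply: is_section_sub hU; exact: subIsetl.
have hV' : is_section D (W `&` f @^-1` O) V by apply: is_section_sub hV; exact: subIsetl.
have W'x : (W `&` f @^-1` O) x by [].
have odd1 : ~~ odd_perm (1 : 'S_3)%g by rewrite odd_perm1.
have H' := H O J oO hJ _ U V oW' (@subIsetr _ _ _) hU' hV' 1%g odd1 x W'x.
exact: (key O J _ U V 1%g x oO hJ oW' (@subIsetr _ _ _) hU' hV' W'x).1 H' u uD.
Qed.
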